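(* Let $\mathcal{E}$ be a set of extension axioms and $\Gamma\to\Delta$ a sequent of eNDT formulas. If the game $\mathsf{NB}$ over $\mathcal{E}$ has a proof (winning strategy from $\{\Gamma\mapsto1,\Delta\mapsto0\}$) of size $N$, then $\mathsf{eLNDT}$ has a proof of $\Gamma\to\Delta$ of size polynomial in $N$ over some set of extension axioms $\mathcal{E}'\supseteq\mathcal{E}$.
   Context: Syntax. Fix propositional variables $p,q,\dots$ and disjoint extension variables $e_0,e_1,\dots$. eNDT formulas: $A,B ::= 0 \mid 1 \mid ApB \mid A\lor B \mid e_i$ with $p$ a propositional variable ($ApB$ means ''if $p$ then $B$ else $A$''); $p$ is identified with $0p1$. A set of extension axioms is $\mathcal{E}=\{e_i\leftrightarrow E_i\}_{i<n}$ with each $E_i$ an eNDT formula containing only extension variables among $e_0,\dots,e_{i-1}$. Sequents are pairs of finite lists. $\mathsf{LNDT}$ rules: identity $A\to A$; cut; exchange, weakening, contraction on both sides; axiom $0\to$; from $\Gamma\to\Delta$ infer $\Gamma,1\to\Delta$ and $\Gamma\to\Delta,0$; axiom $\to1$; $\lor$-left (from $\Gamma,A\to\Delta$ and $\Gamma,B\to\Delta$ infer $\Gamma,A\lor B\to\Delta$); $\lor$-right (from $\Gamma\to\Delta,A,B$ infer $\Gamma\to\Delta,A\lor B$); $p$-left (from $\Gamma,A\to\Delta,p$ and $\Gamma,p,B\to\Delta$ infer $\Gamma,ApB\to\Delta$); $p$-right (from $\Gamma\to\Delta,A,p$ and $\Gamma,p\to\Delta,B$ infer $\Gamma\to\Delta,ApB$).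 An $\mathsf{eLNDT}$ proof over $\mathcal{E}$: a finite list of sequents, each a hypothesis $e_i\to E_i$ or $E_i\to e_i$ from $\mathcal{E}$ or derived from earlier ones by an $\mathsf{LNDT}$ rule; size = number of symbols. Simulation: $A\succeq_\mathcal{E} B$ is the smallest relation with: $A\succeq A$; $A\succeq C, A\succeq D\Rightarrow A\succeq C\lor D$; $A\succeq E_i\Rightarrow A\succeq e_i$; $A\succeq C, B\succeq D\Rightarrow ApB\succeq CpD$; $A_j\succeq B\Rightarrow A_0\lor A_1\succeq B$ ($j\in\{0,1\}$); $E_i\succeq B\Rightarrow e_i\succeq B$. Game $\mathsf{NB}$ over $\mathcal{E}$: queries $P,Q::=A\mid\neg Q\mid Q\lor R\mid Q\land R$ with $A$ eNDT. Simple contradictions: $\{0\mapsto1\}$, $\{1\mapsto0\}$; $\{A_0\mapsto b_0,A_1\mapsto b_1,p\mapsto i,A_0pA_1\mapsto c\}$ with $c\ne b_i$; sets inconsistent with the truth tables of $\neg,\lor,\land$ ($\{Q\mapsto b,\neg Q\mapsto b\}$, $\{Q_0\lor Q_1\mapsto0,Q_i\mapsto1\}$, $\{Q_0\lor Q_1\mapsto1,Q_0\mapsto0,Q_1\mapsto0\}$, $\{Q_0\land Q_1\mapsto0,Q_0\mapsto1,Q_1\mapsto1\}$, $\{Q_0\land Q_1\mapsto1,Q_i\mapsto0\}$); $\{e_i\mapsto b,E_i\mapsto1-b\}$; $\{A\mapsto0,B\mapsto1\}$ whenever $A\succeq_\mathcal{E}B$. A winning strategy from a state $S$ (set of Boolean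 assignments to queries) is a finite binary tree with internal nodes labelled by queries and outgoing edges labelled $0,1$, such that along every root-to-leaf path $S$ plus the assignments made contains a simple contradiction. A proof of $\Gamma\to\Delta$ is a winning strategy from $\{\Gamma\mapsto1,\Delta\mapsto0\}$; its size is the number of symbols in it.
   Formalization: The size N counts the symbols of the extension axioms 𝓔 and of the initial state {Γ↦1, Δ↦0} along with those of the strategy tree; with the tree alone the claim fails (E_0 = p, E_{i+1} = e_i∨e_i: a one-leaf tree proves e_n→e_0, but every eLNDT proof needs n axioms). *)

(* Defs.v *)
From Stdlib Require Import List Arith.
Import ListNotations.

Inductive fml : Type :=
| F0 : fml
| F1 : fml
| FDec : fml -> nat -> fml -> fml  (* [FDec A p B] is ApB: if p then B else A *)
| FOr : fml -> fml -> fml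
| FExt : nat -> fml.

Definition pvar (p : nat) : fml := FDec F0 p F1.

Fixpoint ext_vars_below (n : nat) (A : fml) : Prop :=
  match A with
  | F0 | F1 => True
  | FDec B _ C => ext_vars_below n B /\ ext_vars_below n C
  | FOr B C => ext_vars_below n B /\ ext_vars_below n C
  | FExt i => i < n
  end.

(* The list [E_0; ...; E_(n-1)] stands for {e_i <-> E_i}_{i<n}. *)
Definition axiom_list : Type := list fml.

Definition in_axioms (E : axiom_list) (i : nat) (A : fml) : Prop :=
  nth_error E i = Some A.

Definition ext_axioms (E : axiom_list) : Prop :=
  forall i A, in_axioms E i A -> ext_vars_below i A.

Definition axioms_incl (E E' : axiom_list) : Prop :=
  forall i A, in_axioms E i A -> in_axioms E' i A.

Definition sequent : Type := (list fml * list fml)%type.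

(* [LNDT_rule premises conclusion] *)
Inductive LNDT_rule : list sequent -> sequent -> Prop :=
| R_id A : LNDT_rule [] ([A], [A])
| R_cut G D A :
    LNDT_rule [(G, D ++ [A]); (G ++ [A], D)] (G, D)
| R_exL G A B G' D :
    LNDT_rule [(G ++ A :: B :: G', D)] (G ++ B :: A :: G', D)
| R_exR G D A B D' :
    LNDT_rule [(G, D ++ A :: B :: D')] (G, D ++ B :: A :: D')
| R_wkL G D A : LNDT_rule [(G, D)] (G ++ [A], D)
| R_wkR G D A : LNDT_rule [(G, D)] (G, D ++ [A])
| R_ctrL G D A : LNDT_rule [(G ++ [A; A], D)] (G ++ [A], D)
| R_ctrR G D A : LNDT_rule [(G, D ++ [A; A])] (G, D ++ [A])
| R_0L : LNDT_rule [] ([F0], [])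
| R_1L G D : LNDT_rule [(G, D)] (G ++ [F1], D)
| R_0R G D : LNDT_rule [(G, D)] (G, D ++ [F0])
| R_1R : LNDT_rule [] ([], [F1])
| R_orL G D A B :
    LNDT_rule [(G ++ [A], D); (G ++ [B], D)] (G ++ [FOr A B], D)
| R_orR G D A B :
    LNDT_rule [(G, D ++ [A; B])] (G, D ++ [FOr A B])
| R_pL G D A p B :
    LNDT_rule [(G ++ [A], D ++ [pvar p]); (G ++ [pvar p; B], D)]
              (G ++ [FDec A p B], D)
| R_pR G D A p B :
    LNDT_rule [(G, D ++ [A; pvar p]); (G ++ [pvar p], D ++ [B])]
              (G, D ++ [FDec A p B]).

Inductive ext_hypothesis (E : axiom_list) : sequent -> Prop :=
| hyp_unfold i A : in_axioms E i A -> ext_hypothesis E ([FExt i], [A])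
| hyp_fold i A : in_axioms E i A -> ext_hypothesis E ([A], [FExt i]).

Inductive eLNDT_derivation (E : axiom_list) : list sequent -> Prop :=
| der_nil : eLNDT_derivation E []
| der_hyp pi s :
    eLNDT_derivation E pi -> ext_hypothesis E s ->
    eLNDT_derivation E (pi ++ [s])
| der_rule pi prems s :
    eLNDT_derivation E pi -> LNDT_rule prems s -> incl prems pi ->
    eLNDT_derivation E (pi ++ [s]).

Definition eLNDT_proof (E : axiom_list) (pi : list sequent) (s : sequent)
  : Prop :=
  eLNDT_derivation E pi /\ exists pi', pi = pi' ++ [s].

Inductive simulates (E : axiom_list) : fml -> fml -> Prop :=
| sim_refl A : simulates E A A
| sim_orR A C D :
    simulates E A C -> simulates E A D -> simulates E A (FOr C D)
| sim_extR A i Ei :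
    in_axioms E i Ei -> simulates E A Ei -> simulates E A (FExt i)
| sim_dec A p B C D :
    simulates E A C -> simulates E B D -> simulates E (FDec A p B) (FDec C p D)
| sim_orL0 A0 A1 B : simulates E A0 B -> simulates E (FOr A0 A1) B
| sim_orL1 A0 A1 B : simulates E A1 B -> simulates E (FOr A0 A1) B
| sim_extL i Ei B :
    in_axioms E i Ei -> simulates E Ei B -> simulates E (FExt i) B.

Inductive query : Type :=
| QF : fml -> query
| QNeg : query -> query
| QOr : query -> query -> query
| QAnd : query -> query -> query.

(* [QF (FOr A B)] and [QOr (QF A) (QF B)] both represent the query written
   A \/ B, so the truth table of disjunction must apply to both. *)
Inductive is_or : query -> query -> query -> Prop :=
| is_or_fml A B : is_or (QF (FOr A B)) (QF A) (QF B)
| is_or_query Q R : is_or (QOr Q R) Q R.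

Definition state : Type := list (query * bool).

Inductive simple_contradiction (E : axiom_list) : state -> Prop :=
| sc_0 : simple_contradiction E [(QF F0, true)]
| sc_1 : simple_contradiction E [(QF F1, false)]
| sc_dec A0 A1 p (b0 b1 i c : bool) :
    c <> (if i then b1 else b0) ->
    simple_contradiction E
      [(QF A0, b0); (QF A1, b1); (QF (pvar p), i); (QF (FDec A0 p A1), c)]
| sc_neg Q (b : bool) : simple_contradiction E [(Q, b); (QNeg Q, b)]
| sc_or0 P Q0 Q1 (i : bool) :
    is_or P Q0 Q1 ->
    simple_contradiction E [(P, false); (if i then Q1 else Q0, true)]
| sc_or1 P Q0 Q1 :
    is_or P Q0 Q1 ->
    simple_contradiction E [(P, true); (Q0, false); (Q1, false)]
| sc_and0 Q0 Q1 :
    simple_contradiction E [(QAnd Q0 Q1, false); (Q0, true); (Q1, true)]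
| sc_and1 Q0 Q1 (i : bool) :
    simple_contradiction E [(QAnd Q0 Q1, true); (if i then Q1 else Q0, false)]
| sc_ext i Ei (b : bool) :
    in_axioms E i Ei ->
    simple_contradiction E [(QF (FExt i), b); (QF Ei, negb b)]
| sc_sim A B :
    simulates E A B -> simple_contradiction E [(QF A, false); (QF B, true)].

(* [SNode Q T0 T1]: query Q, then T0 on answer 0 and T1 on answer 1. *)
Inductive strategy : Type :=
| SLeaf : strategy
| SNode : query -> strategy -> strategy -> strategy.

Fixpoint winning (E : axiom_list) (S : state) (T : strategy) : Prop :=
  match T with
  | SLeaf => exists C, simple_contradiction E C /\ incl C S
  | SNode Q T0 T1 =>
      winning E ((Q, false) :: S) T0 /\ winning E ((Q, true) :: S) T1
  end.

Definition initial_state (G D : list fml) : state :=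
  map (fun A => (QF A, true)) G ++ map (fun A => (QF A, false)) D.

Definition NB_proof (E : axiom_list) (G D : list fml) (T : strategy) : Prop :=
  winning E (initial_state G D) T.

(* Sizes count symbols; a variable is one symbol, and parentheses and commas
   (a constant factor) are not counted. *)
Fixpoint fml_size (A : fml) : nat :=
  match A with
  | F0 | F1 | FExt _ => 1
  | FDec B _ C => fml_size B + 1 + fml_size C
  | FOr B C => fml_size B + 1 + fml_size C
  end.

Fixpoint query_size (Q : query) : nat :=
  match Q with
  | QF A => fml_size A
  | QNeg R => 1 + query_size R
  | QOr R R' | QAnd R R' => query_size R + 1 + query_size R'
  end.

Definition sequent_size (s : sequent) : nat :=
  list_sum (map fml_size (fst s)) + 1 + list_sum (map fml_size (snd s)).

Definition eLNDT_size (pi : list sequent) : nat :=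
  list_sum (map sequent_size pi).

Definition axioms_size (E : axiom_list) : nat :=
  list_sum (map (fun A => 2 + fml_size A) E).

Definition state_size (S : state) : nat :=
  list_sum (map (fun a => query_size (fst a) + 2) S).

(* Each internal node carries its query and the labels 0, 1 of its edges. *)
Fixpoint strategy_size (T : strategy) : nat :=
  match T with
  | SLeaf => 1
  | SNode Q T0 T1 => query_size Q + 2 + strategy_size T0 + strategy_size T1
  end.

(* A winning strategy is presented together with the axioms it is over and the
   state it starts from, and both are counted. With the tree alone, no bound
   could hold: for E_0 = p and E_(i+1) = e_i \/ e_i, the one-leaf tree proves
   e_n -> e_0, whereas an eLNDT proof has to use all of E_1, ..., E_n; and the
   one-leaf tree proves 0, A -> for A of any size. *)
Definition NB_size (E : axiom_list) (G D : list fml) (T : strategy) : nat :=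
  axioms_size E + state_size (initial_state G D) + strategy_size T.

(* Main.v *)
Require Import Defs.
From Stdlib Require Import List Arith Lia Bool Sorting.Sorted.
Import ListNotations.

(** eNDT formulas have no negation, so negated queries are eliminated with
    slices. Let L be the list of all eNDT formulas occurring in the queries and
    let Th_k say that at least k members of L are true. When exactly k members
    of L are true, the negation of A in L is equivalent to "at least k members
    of L other than A are true". With this reading of negated atoms every query
    Q and every value b has a positive translation, and along the strategy one
    proves the sequents Th_k, S -> Th_(k+1) for all its states S. The root
    gives Th_k, Gamma -> Delta, Th_(k+1) for every k <= |L|, and cutting along
    k = 0, ..., |L| gives Gamma -> Delta, since Th_0 is valid and Th_(|L|+1) is
    refutable.

    Threshold formulas and conjunctions are expressed by extension variables:
    A /\ B is the branching program A with its 1-leaves redirected to B.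

    For the size, it is enough to count the key sequents from which everything
    follows by cut trees of constant depth. *)

(** Within a slice the two translations of a query are dual, not complementary. That at least one of
    them holds needs Th_k on the left; that not both hold needs Th_(k+1) on the right. Hence every
    sequent carries both thresholds. Redirecting the 1-leaves of A to B must also redirect those
    hidden behind the extension variables of A, so a fresh name is needed for each pair of a place
    in A and a continuation. Names are therefore stacks of pending tasks. They stay polynomially
    many because, within a query, the pending tasks are determined by the place that has been
    reached. The inductions follow the unfolding of extension variables and the derivations of
    simulations, both of which may be exponentially large as trees. The ranks used below are
    exponential too, but serve only as an order; the size is controlled by the number of distinct
    sequents met. *)

Lemma fml_eq_dec (A B : fml) : {A = B} + {A <> B}.
Proof. decide equality; apply Nat.eq_dec. Defined.

Lemma sequent_eq_dec (s t : sequent) : {s = t} + {s <> t}.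
Proof. decide equality; apply (list_eq_dec fml_eq_dec). Defined.

Definition fmls_size (G : list fml) : nat := list_sum (map fml_size G).

Lemma fmls_size_cons A G : fmls_size (A :: G) = fml_size A + fmls_size G.
Proof. reflexivity. Qed.

Lemma fmls_size_app G G' : fmls_size (G ++ G') = fmls_size G + fmls_size G'.
Proof. unfold fmls_size. now rewrite map_app, list_sum_app. Qed.

Lemma sequent_size_pair G D :
  sequent_size (G, D) = fmls_size G + 1 + fmls_size D.
Proof. reflexivity. Qed.

Lemma fml_size_le_in A G : In A G -> fml_size A <= fmls_size G.
Proof.
  induction G as [|B G IH]; simpl; [easy|].
  rewrite fmls_size_cons. intros [->|H]; [lia|]. specialize (IH H). lia.
Qed.

Lemma fmls_size_incl G G' :
  incl G G' -> fmls_size G <= length G * fmls_size G'.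
Proof.
  induction G as [|A G IH]; intros H; [simpl; unfold fmls_size; simpl; lia|].
  rewrite fmls_size_cons. simpl.
  pose proof (fml_size_le_in A G' (H A (or_introl eq_refl))).
  pose proof (IH (fun x hx => H x (or_intror hx))). lia.
Qed.

(** * Deductions with bounded length and bounded line size *)

Section Deduction.
Variables (E : axiom_list) (M : nat).

(** Quantifying over every derivation that contains [H] lets deductions be chained by appending,
    later ones reusing earlier lines. Length and line size are bounded separately; their product
    bounds the size. *)
Definition deducible (H : list sequent) (c : nat) (s : sequent) : Prop :=
  forall pi, eLNDT_derivation E pi -> incl H pi ->
  exists ext, eLNDT_derivation E (pi ++ ext) /\ In s (pi ++ ext) /\
    Forall (fun s => sequent_size s <= M) ext /\ length ext <= c.

Lemma deducible_le H c c' s : deducible H c s -> c <= c' -> deducible H c' s.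
Proof.
  intros h hc pi hpi hH. destruct (h pi hpi hH) as (ext & h1 & h2 & h3 & h4).
  exists ext. repeat split; auto; lia.
Qed.

Lemma deducible_in H s : In s H -> deducible H 0 s.
Proof.
  intros h pi hpi hH. exists []. rewrite app_nil_r. repeat split; auto.
Qed.

Lemma deducible_hyp H s :
  ext_hypothesis E s -> sequent_size s <= M -> deducible H 1 s.
Proof.
  intros h hs pi hpi hH. exists [s]. repeat split; auto.
  - now apply der_hyp.
  - apply in_or_app; simpl; auto.
Qed.

Lemma deducible_rule0 H s :
  LNDT_rule [] s -> sequent_size s <= M -> deducible H 1 s.
Proof.
  intros h hs pi hpi hH. exists [s]. repeat split; auto.
  - apply der_rule with []; auto. easy.
  - apply in_or_app; simpl; auto.
Qed.

Lemma deducible_rule1 H c s1 s :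
  deducible H c s1 -> LNDT_rule [s1] s -> sequent_size s <= M ->
  deducible H (c + 1) s.
Proof.
  intros h1 h hs pi hpi hH.
  destruct (h1 pi hpi hH) as (ext & a1 & a2 & a3 & a4).
  exists (ext ++ [s]). rewrite app_assoc. repeat split.
  - apply der_rule with [s1]; auto. intros x [<-|[]]; auto.
  - apply in_or_app; simpl; auto.
  - apply Forall_app; auto.
  - rewrite length_app; simpl; lia.
Qed.

Lemma deducible_rule2 H c1 c2 s1 s2 s :
  deducible H c1 s1 -> deducible H c2 s2 -> LNDT_rule [s1; s2] s ->
  sequent_size s <= M -> deducible H (c1 + c2 + 1) s.
Proof.
  intros h1 h2 h hs pi hpi hH.
  destruct (h1 pi hpi hH) as (ext & a1 & a2 & a3 & a4).
  destruct (h2 (pi ++ ext) a1) as (ext' & b1 & b2 & b3 & b4).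
  { intros x hx. apply in_or_app; auto. }
  exists (ext ++ ext' ++ [s]). rewrite !app_assoc. repeat split.
  - apply der_rule with [s1; s2]; auto.
    intros x [<-|[<-|[]]]; auto. apply in_or_app; auto.
  - apply in_or_app; simpl; auto.
  - rewrite !Forall_app; auto.
  - rewrite !length_app; simpl; lia.
Qed.

(* [mk] is one side of a sequent whose other side is fixed, so that the
   structural rules are treated once for both sides. *)
Section OneSide.
Variables (mk : list fml -> sequent) (b : nat) (H : list sequent).
Hypothesis mk_ex : forall G A B G',
  LNDT_rule [mk (G ++ A :: B :: G')] (mk (G ++ B :: A :: G')).
Hypothesis mk_wk : forall G A, LNDT_rule [mk G] (mk (G ++ [A])).
Hypothesis mk_ctr : forall G A, LNDT_rule [mk (G ++ [A; A])] (mk (G ++ [A])).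
Hypothesis mk_size : forall G, fmls_size G <= b -> sequent_size (mk G) <= M.

Lemma deducible_move_right x Q : forall P S c,
  fmls_size (P ++ x :: Q ++ S) <= b ->
  deducible H c (mk (P ++ x :: Q ++ S)) ->
  deducible H (c + length Q) (mk (P ++ Q ++ x :: S)).
Proof.
  induction Q as [|y Q IH]; intros P S c hs h; simpl in *.
  - now rewrite Nat.add_0_r.
  - replace (P ++ y :: Q ++ x :: S) with ((P ++ [y]) ++ Q ++ x :: S)
      by now rewrite <- app_assoc.
    apply deducible_le with ((c + 1) + length Q); [|lia].
    assert (hs' : fmls_size (P ++ y :: x :: Q ++ S) <= b).
    { rewrite fmls_size_app, !fmls_size_cons in *. lia. }
    apply IH; rewrite <- app_assoc; simpl; [exact hs'|].
    apply deducible_rule1 with (1 := h); auto.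
Qed.

Lemma deducible_move_left x Q : forall P S c,
  fmls_size (P ++ Q ++ x :: S) <= b ->
  deducible H c (mk (P ++ Q ++ x :: S)) ->
  deducible H (c + length Q) (mk (P ++ x :: Q ++ S)).
Proof.
  induction Q as [|y Q IH]; intros P S c hs h; simpl in *.
  - now rewrite Nat.add_0_r.
  - apply deducible_le with ((c + length Q) + 1); [|lia].
    assert (e : P ++ y :: Q ++ x :: S = (P ++ [y]) ++ Q ++ x :: S)
      by now rewrite <- app_assoc.
    rewrite e in *.
    apply IH in h; [|assumption].
    rewrite <- app_assoc in h. simpl in h.
    apply deducible_rule1 with (1 := h); auto.
    apply mk_size.
    repeat (rewrite ?fmls_size_app, ?fmls_size_cons in * ).
    change (fmls_size []) with 0 in *. lia.
Qed.

Lemma deducible_append G' : forall G c,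
  fmls_size (G ++ G') <= b -> deducible H c (mk G) ->
  deducible H (c + length G') (mk (G ++ G')).
Proof.
  induction G' as [|y G' IH]; intros G c hs h; simpl in *.
  - now rewrite app_nil_r, Nat.add_0_r.
  - replace (G ++ y :: G') with ((G ++ [y]) ++ G') in *
      by now rewrite <- app_assoc.
    apply deducible_le with ((c + 1) + length G'); [|lia].
    apply IH; auto.
    apply deducible_rule1 with (1 := h); auto.
    apply mk_size. rewrite !fmls_size_app in *. lia.
Qed.

(** Each [x] of [G] is moved to the right end, its copy in [G'] is moved next to it, the two are
    contracted, and the survivor returns to the place of the copy: three passes of exchanges and one
    contraction per formula. *)
Lemma deducible_absorb G' G : forall c,
  incl G G' -> fmls_size (G ++ G') <= b -> deducible H c (mk (G ++ G')) ->
  deducible H (c + length G * (3 * (length G + length G') + 1)) (mk G').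
Proof.
  induction G as [|x G IH]; intros c hi hs h; simpl in *.
  - now rewrite Nat.add_0_r.
  - assert (hx : In x G') by (apply hi; simpl; auto).
    apply in_split in hx. destruct hx as (Ga & Gb & hG').
    assert (hs' := hs). rewrite fmls_size_cons in hs'.
    assert (hl : length G' = length Ga + S (length Gb))
      by (rewrite hG', length_app; reflexivity).
    assert (sz : fmls_size (G ++ G') =
      fmls_size G + fmls_size Ga + fml_size x + fmls_size Gb).
    { rewrite hG', !fmls_size_app, fmls_size_cons. lia. }
    assert (sz1 : fmls_size [x] = fml_size x) by (unfold fmls_size; simpl; lia).
    assert (sz0 : fmls_size [] = 0) by reflexivity.
    assert (h1 : deducible H (c + length (G ++ G')) (mk ((G ++ G') ++ [x]))).
    { apply (deducible_move_right x (G ++ G') [] []); rewrite app_nil_r; auto. }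
    assert (h2 : deducible H ((c + length (G ++ G')) + length Gb)
                   (mk ((G ++ Ga) ++ Gb ++ [x; x]))).
    { apply (deducible_move_right x Gb (G ++ Ga) [x]).
      - repeat rewrite ?fmls_size_app, ?fmls_size_cons. lia.
      - replace ((G ++ Ga) ++ x :: Gb ++ [x]) with ((G ++ G') ++ [x]); auto.
        rewrite hG'. repeat (rewrite <- ?app_assoc; simpl). reflexivity. }
    assert (h3 : deducible H ((c + length (G ++ G')) + length Gb + 1)
                   (mk ((G ++ Ga) ++ Gb ++ [x]))).
    { rewrite app_assoc in h2 |- *. apply deducible_rule1 with (1 := h2); auto.
      apply mk_size. repeat rewrite ?fmls_size_app, ?fmls_size_cons. lia. }
    assert (h4 : deducible H ((c + length (G ++ G')) + length Gb + 1 + length Gb)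
                   (mk (G ++ G'))).
    { replace (G ++ G') with ((G ++ Ga) ++ x :: Gb ++ [])
        by (rewrite hG', app_nil_r, <- app_assoc; reflexivity).
      rewrite <- app_assoc in h3 |- *.
      rewrite app_assoc. rewrite app_assoc in h3.
      apply deducible_move_left.
      - repeat rewrite ?fmls_size_app, ?fmls_size_cons. lia.
      - eapply deducible_le; [exact h3|].
        rewrite !length_app. simpl. rewrite !length_app. simpl. lia. }
    apply IH in h4; [|intros y hy; apply hi; simpl; auto|lia].
    eapply deducible_le; [exact h4|].
    rewrite !length_app, hl. lia.
Qed.

(** Inclusion as sets is realised by appending all of [G'], at most [l] weakenings, and then
    absorbing [G] into it, at most [6 * l + 1] steps per formula. *)
Lemma deducible_incl G G' c l :
  incl G G' -> fmls_size (G ++ G') <= b ->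
  length G <= l -> length G' <= l -> deducible H c (mk G) ->
  deducible H (c + (l + l * (6 * l + 1))) (mk G').
Proof.
  intros hi hs h1 h2 h.
  apply deducible_append with (G' := G') in h; auto.
  apply deducible_absorb in h; auto.
  eapply deducible_le; [exact h|]. nia.
Qed.
End OneSide.

(** One application of [deducible_incl] for each side of the sequent. *)
Definition weakening_cost (l : nat) : nat := 2 * (l + l * (6 * l + 1)).

Lemma deducible_weakening H G D G' D' c l b :
  incl G G' -> incl D D' ->
  length G <= l -> length G' <= l -> length D <= l -> length D' <= l ->
  fmls_size G <= b -> fmls_size G' <= b ->
  fmls_size D <= b -> fmls_size D' <= b -> 4 * b + 1 <= M ->
  deducible H c (G, D) -> deducible H (c + weakening_cost l) (G', D').
Proof.
  intros hG hD l1 l2 l3 l4 b1 b2 b3 b4 hM h.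
  apply (deducible_incl (fun G => (G, D)) (2 * b)) with (G' := G') (l := l) in h;
    auto; try (intros; constructor);
    try (rewrite fmls_size_app; lia);
    try (intros; rewrite sequent_size_pair; lia).
  apply (deducible_incl (fun D => (G', D)) (2 * b)) with (G' := D') (l := l) in h;
    auto; try (intros; constructor);
    try (rewrite fmls_size_app; lia);
    try (intros; rewrite sequent_size_pair; lia).
  eapply deducible_le; [exact h|]. unfold weakening_cost. lia.
Qed.

Lemma deducible_id H G D A l b :
  In A G -> In A D -> 1 <= l -> length G <= l -> length D <= l ->
  fmls_size G <= b -> fmls_size D <= b -> 4 * b + 1 <= M ->
  deducible H (1 + weakening_cost l) (G, D).
Proof.
  intros hG hD h1 l1 l2 b1 b2 hM.
  pose proof (fml_size_le_in _ _ hG).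
  assert (fmls_size [A] = fml_size A) by (unfold fmls_size; simpl; lia).
  apply deducible_weakening with (G := [A]) (D := [A]) (b := b); auto; try lia.
  - intros x [<-|[]]; auto.
  - intros x [<-|[]]; auto.
  - apply deducible_rule0; [constructor|]. rewrite sequent_size_pair. lia.
Qed.

(** * Basic sequents and cut trees *)

(** The logical rules and the extension hypotheses, recast as sequents without side formulas. Over
    them cut and the structural rules suffice, so a derivation becomes a case distinction over cut
    formulas. *)
Inductive basic_sequent : list fml -> list fml -> Prop :=
| bs_id A : basic_sequent [A] [A]
| bs_0 : basic_sequent [F0] []
| bs_1 : basic_sequent [] [F1]
| bs_orR0 A B : basic_sequent [A] [FOr A B]
| bs_orR1 A B : basic_sequent [B] [FOr A B]
| bs_orL A B : basic_sequent [FOr A B] [A; B]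
| bs_decR0 A p B : basic_sequent [A] [pvar p; FDec A p B]
| bs_decR1 A p B : basic_sequent [pvar p; B] [FDec A p B]
| bs_decL0 A p B : basic_sequent [FDec A p B] [A; pvar p]
| bs_decL1 A p B : basic_sequent [pvar p; FDec A p B] [B]
| bs_unfold i A : in_axioms E i A -> basic_sequent [FExt i] [A]
| bs_fold i A : in_axioms E i A -> basic_sequent [A] [FExt i].

Lemma basic_sequent_length G D :
  basic_sequent G D -> length G <= 2 /\ length D <= 2.
Proof. destruct 1; simpl; lia. Qed.

Ltac small_size :=
  rewrite ?sequent_size_pair in *; unfold fmls_size in *; simpl in *; lia.
Ltac small_id A b :=
  apply (deducible_id _ _ _ A 3 b); [simpl; tauto|simpl; tauto|..]; small_size.

(** Each is an axiom, a hypothesis, or one rule applied to at most two identities padded by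
    weakening. The sides of these premises have at most three formulas and size at most [3 * b], and
    padding needs four times that: hence [12 * b + 1]. *)
Lemma deducible_basic H G D b :
  basic_sequent G D -> fmls_size G <= b -> fmls_size D <= b -> 12 * b + 1 <= M ->
  deducible H (3 + 2 * weakening_cost 3) (G, D).
Proof.
  intros h hG hD hM. destruct h.
  - eapply deducible_le; [apply deducible_rule0; [constructor|small_size]|lia].
  - eapply deducible_le; [apply deducible_rule0; [constructor|small_size]|lia].
  - eapply deducible_le; [apply deducible_rule0; [constructor|small_size]|lia].
  - eapply deducible_le;
      [eapply deducible_rule1;
        [|apply (R_orR [A] [] A B)|small_size]; small_id A (3 * b)|lia].
  - eapply deducible_le;
      [eapply deducible_rule1;
        [|apply (R_orR [B] [] A B)|small_size]; small_id B (3 * b)|lia].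
  - eapply deducible_le;
      [eapply deducible_rule2;
        [| |apply (R_orL [] [A; B] A B)|small_size];
        [small_id A (3 * b)|small_id B (3 * b)]|lia].
  - eapply deducible_le;
      [eapply deducible_rule2;
        [| |apply (R_pR [A] [pvar p] A p B)|small_size];
        [small_id A (3 * b)|small_id (pvar p) (3 * b)]|lia].
  - eapply deducible_le;
      [eapply deducible_rule2;
        [| |apply (R_pR [pvar p; B] [] A p B)|small_size];
        [small_id (pvar p) (3 * b)|small_id B (3 * b)]|lia].
  - eapply deducible_le;
      [eapply deducible_rule2;
        [| |apply (R_pL [] [A; pvar p] A p B)|small_size];
        [small_id A (3 * b)|small_id (pvar p) (3 * b)]|lia].
  - eapply deducible_le;
      [eapply deducible_rule2;
        [| |apply (R_pL [pvar p] [B] A p B)|small_size];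
        [small_id (pvar p) (3 * b)|small_id B (3 * b)]|lia].
  - eapply deducible_le; [apply deducible_hyp; [now constructor|small_size]|lia].
  - eapply deducible_le; [apply deducible_hyp; [now constructor|small_size]|lia].
Qed.

(** [n] bounds the depth and [z] the size of the cut formulas. Leaves compare sides as sets, which
    leaves all structural rules to [deducible_cut_tree]. *)
Inductive cut_tree (z : nat) (H : sequent -> Prop) :
    nat -> list fml -> list fml -> Prop :=
| ct_basic n G0 D0 G D :
    basic_sequent G0 D0 -> incl G0 G -> incl D0 D -> cut_tree z H n G D
| ct_key n G0 D0 G D :
    H (G0, D0) -> incl G0 G -> incl D0 D -> cut_tree z H n G D
| ct_cut n A G D :
    fml_size A <= z -> cut_tree z H n (A :: G) D -> cut_tree z H n G (A :: D) ->
    cut_tree z H (S n) G D.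

Lemma cut_tree_mono z (H H' : sequent -> Prop) n G D :
  (forall s, H s -> H' s) -> cut_tree z H n G D -> cut_tree z H' n G D.
Proof.
  intros hH h. induction h.
  - eapply ct_basic; eauto.
  - eapply ct_key; eauto.
  - eapply ct_cut; eauto.
Qed.

(** A finite tree uses finitely many members of [H]; this passes from a predicate to the list of
    hypotheses that [deducible] expects. *)
Lemma cut_tree_finite z (H : sequent -> Prop) n G D :
  cut_tree z H n G D ->
  exists l, (forall s, In s l -> H s) /\ cut_tree z (fun s => In s l) n G D.
Proof.
  induction 1 as [n G0 D0 G D h1 h2 h3|n G0 D0 G D h1 h2 h3
                 |n A G D hA _ (l1 & a1 & b1) _ (l2 & a2 & b2)].
  - exists []. split; [easy|]. eapply ct_basic; eauto.
  - exists [(G0, D0)]. split; [now intros s [<-|[]]|].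
    eapply ct_key; eauto. simpl; auto.
  - exists (l1 ++ l2). split.
    + intros s hs. apply in_app_or in hs as [hs|hs]; auto.
    + apply ct_cut with A; auto.
      * eapply cut_tree_mono; [|exact b1]. intros; apply in_or_app; auto.
      * eapply cut_tree_mono; [|exact b2]. intros; apply in_or_app; auto.
Qed.

(** [w] is the cost of one structural adjustment of a sequent. The cost doubles with every level,
    which is harmless because the depth will be the constant 16. *)
Fixpoint cut_tree_cost (n w : nat) : nat :=
  match n with
  | 0 => 3 + 3 * w
  | S n => 2 * (cut_tree_cost n w + w) + 1
  end.

Lemma cut_tree_cost_ge n w : 3 + 3 * w <= cut_tree_cost n w.
Proof. induction n; simpl; lia. Qed.

Lemma weakening_cost_mono l l' :
  l <= l' -> weakening_cost l <= weakening_cost l'.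
Proof. unfold weakening_cost. nia. Qed.

Definition narrow (k b : nat) (s : sequent) : Prop :=
  length (fst s) <= k /\ length (snd s) <= k /\
  fmls_size (fst s) <= b /\ fmls_size (snd s) <= b.

(** Every cut adds one formula of size at most [z] to a side, so the remaining depth [n] reserves
    [n] places and [n * z] symbols. *)
Lemma deducible_cut_tree z H n G D k b :
  3 <= k -> (forall s, In s H -> narrow k b s) -> 24 * b + 1 <= M ->
  cut_tree z (fun s => In s H) n G D ->
  length G + n <= k -> length D + n <= k ->
  fmls_size G + n * z <= b -> fmls_size D + n * z <= b ->
  deducible H (cut_tree_cost n (weakening_cost k)) (G, D).
Proof.
  intros hk hH hM h.
  induction h as [n G0 D0 G D h1 h2 h3|n G0 D0 G D h1 h2 h3
                 |n A G D hA h1 IH1 h2 IH2]; intros l1 l2 s1 s2.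
  (* The sides of a basic sequent may repeat a formula, so inclusion in a side of size [b] bounds
     them only by [2 * b]; the requirement [12 * (2 * b) + 1] is the origin of 24. *)
  - pose proof (basic_sequent_length _ _ h1) as [m1 m2].
    pose proof (fmls_size_incl _ _ h2). pose proof (fmls_size_incl _ _ h3).
    pose proof (cut_tree_cost_ge n (weakening_cost k)).
    pose proof (weakening_cost_mono 3 k hk).
    eapply deducible_le;
      [apply deducible_weakening with (l := k) (b := 2 * b) (2 := h3) (1 := h2);
         try nia; apply deducible_basic with (1 := h1) (b := 2 * b); nia|lia].
  - destruct (hH _ h1) as (m1 & m2 & m3 & m4). simpl in *.
    pose proof (cut_tree_cost_ge n (weakening_cost k)).
    eapply deducible_le;
      [apply deducible_weakening with (l := k) (b := b) (2 := h3) (1 := h2);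
         try nia; apply deducible_in; exact h1|lia].
  - simpl in l1, l2. rewrite Nat.mul_succ_l in *.
    assert (e : forall X, fmls_size (X ++ [A]) = fml_size A + fmls_size X).
    { intros X. rewrite fmls_size_app, fmls_size_cons.
      change (fmls_size []) with 0. lia. }
    eapply deducible_le;
      [eapply deducible_rule2; [| |apply (R_cut G D A)|]|].
    + apply deducible_weakening with (l := k) (b := b) (G := G) (D := A :: D);
        [..|apply IH2]; rewrite ?fmls_size_cons, ?e, ?length_app; simpl;
        try lia; try apply incl_refl.
      intros x [<-|hx]; apply in_or_app; simpl; auto.
    + apply deducible_weakening with (l := k) (b := b) (G := A :: G) (D := D);
        [..|apply IH1]; rewrite ?fmls_size_cons, ?e, ?length_app; simpl;
        try lia; try apply incl_refl.
      intros x [<-|hx]; apply in_or_app; simpl; auto.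
    + rewrite sequent_size_pair. lia.
    + simpl. lia.
Qed.

(* Each key needs to be proved only once, so the number of keys bounds the
   number of cut trees. *)
Definition generated (z : nat) (key : sequent -> Prop) (n : nat) (s : sequent)
  : Prop :=
  forall P : sequent -> Prop,
    (forall G D, key (G, D) -> cut_tree z P n G D -> P (G, D)) -> P s.

(** [generated] is the intersection of all predicates closed under its clause; monotonicity of
    [cut_tree] makes the intersection closed as well. *)
Lemma generated_intro z key n G D :
  key (G, D) -> cut_tree z (generated z key n) n G D ->
  generated z key n (G, D).
Proof.
  intros hk ht P hP. apply hP; auto.
  eapply cut_tree_mono; [|exact ht]. intros s hs. now apply hs.
Qed.

Definition count_in (U pi : list sequent) : nat :=
  length (filter (fun u => if in_dec sequent_eq_dec u pi then true else false) U).

Lemma count_in_app_le U pi ext : count_in U pi <= count_in U (pi ++ ext).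
Proof.
  unfold count_in. induction U as [|u U IH]; simpl; [lia|].
  destruct (in_dec sequent_eq_dec u pi) as [h|h];
    destruct (in_dec sequent_eq_dec u (pi ++ ext)) as [h'|h']; simpl; try lia.
  destruct h'. apply in_or_app; auto.
Qed.

Lemma count_in_app_lt U pi ext s :
  In s U -> ~ In s pi -> In s (pi ++ ext) ->
  count_in U pi < count_in U (pi ++ ext).
Proof.
  intros hU h1 h2. unfold count_in. induction U as [|u U IH]; simpl; [easy|].
  pose proof (count_in_app_le U pi ext) as hle. unfold count_in in hle.
  destruct hU as [->|hU].
  - destruct (in_dec sequent_eq_dec s pi); [easy|].
    destruct (in_dec sequent_eq_dec s (pi ++ ext)); [simpl; lia|easy].
  - specialize (IH hU).
    destruct (in_dec sequent_eq_dec u pi) as [h|h];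
      destruct (in_dec sequent_eq_dec u (pi ++ ext)) as [h'|h']; simpl; try lia.
    destruct h'. apply in_or_app; auto.
Qed.

Lemma generated_deducible z (key : sequent -> Prop) n s (U : list sequent) k b :
  (forall s, key s -> In s U) ->
  (forall s, key s -> length (fst s) + n <= k /\ length (snd s) + n <= k /\
    fmls_size (fst s) + n * z <= b /\ fmls_size (snd s) + n * z <= b) ->
  3 <= k -> 24 * b + 1 <= M ->
  generated z key n s ->
  exists pi, eLNDT_derivation E pi /\ In s pi /\
    Forall (fun s => sequent_size s <= M) pi /\
    length pi <= cut_tree_cost n (weakening_cost k) * length U.
Proof.
  intros hU hkey hk hM hs.
  set (c := cut_tree_cost n (weakening_cost k)).
  (* Amortised count: a cut tree costs at most [c] lines and is built only if its key is not yet a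
     line, so it is paid for by the increase of [count_in U]. Summed up, at most [c * length U]
     lines are written. *)
  set (P := fun s => key s /\ forall pi, eLNDT_derivation E pi ->
    exists ext, eLNDT_derivation E (pi ++ ext) /\ In s (pi ++ ext) /\
      Forall (fun s => sequent_size s <= M) ext /\
      length ext + c * count_in U pi <= c * count_in U (pi ++ ext)).
  assert (hP : P s).
  { apply hs. clear s hs. intros G D hGD ht. split; [exact hGD|].
    intros pi hpi. apply cut_tree_finite in ht. destruct ht as (l & hl & ht).
    assert (hext : exists ext, eLNDT_derivation E (pi ++ ext) /\
      incl l (pi ++ ext) /\
      Forall (fun s => sequent_size s <= M) ext /\
      length ext + c * count_in U pi <= c * count_in U (pi ++ ext)).
    { assert (hl' : forall s, In s l -> P s) by exact hl.
      clear ht hl. induction l as [|s l IH].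
      - exists []. rewrite app_nil_r. repeat split; auto. easy.
      - destruct IH as (ext & a1 & a2 & a3 & a4);
          [intros; apply hl'; simpl; auto|].
        destruct (hl' s (or_introl eq_refl)) as [_ hs].
        destruct (hs _ a1) as (ext' & b1 & b2 & b3 & b4).
        exists (ext ++ ext'). rewrite app_assoc. repeat split; auto.
        + intros x [<-|hx]; auto. apply in_or_app; auto.
        + now apply Forall_app.
        + rewrite length_app. lia. }
    destruct hext as (ext & a1 & a2 & a3 & a4).
    destruct (in_dec sequent_eq_dec (G, D) (pi ++ ext)) as [hin|hin].
    - exists ext. auto.
    - destruct (hkey _ hGD) as (k1 & k2 & k3 & k4). simpl in *.
      assert (hd : deducible l c (G, D)).
      { apply deducible_cut_tree with (z := z) (b := b); auto.
        intros s hs. destruct (hl s hs) as [hs' _].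
        destruct (hkey _ hs') as (? & ? & ? & ?).
        unfold narrow; repeat split; lia. }
      destruct (hd _ a1 a2) as (ext' & b1 & b2 & b3 & b4).
      exists (ext ++ ext'). rewrite app_assoc. repeat split; auto.
      + now apply Forall_app.
      + pose proof (count_in_app_lt U (pi ++ ext) ext' _ (hU _ hGD) hin b2).
        rewrite length_app. nia. }
  destruct hP as [_ hP].
  destruct (hP [] (der_nil E)) as (pi & a1 & a2 & a3 & a4). simpl in *.
  exists pi. repeat split; auto.
  assert (count_in U pi <= length U).
  { unfold count_in. apply filter_length_le. }
  nia.
Qed.

Lemma derivation_prefix pi ext :
  eLNDT_derivation E (pi ++ ext) -> eLNDT_derivation E pi.
Proof.
  induction ext as [|x ext IH] using rev_ind; [now rewrite app_nil_r|].
  rewrite app_assoc. intros h. apply IH.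
  inversion h as [h1|pi' s h1 h2 h3|pi' pr s h1 h2 h3 h4].
  - now destruct (pi ++ ext).
  - now apply app_inj_tail in h3 as [-> _].
  - now apply app_inj_tail in h4 as [-> _].
Qed.
End Deduction.

(** The list is cut off after an occurrence of [s], since a proof has to end with its conclusion. *)
Lemma proof_of_derivation E M pi s :
  eLNDT_derivation E pi -> In s pi ->
  Forall (fun s => sequent_size s <= M) pi ->
  exists pi', eLNDT_proof E pi' s /\ eLNDT_size pi' <= M * length pi.
Proof.
  intros h hs hM. apply in_split in hs as (p1 & p2 & ->).
  exists (p1 ++ [s]). split.
  - split; [|eauto]. apply derivation_prefix with p2.
    now rewrite <- app_assoc.
  - replace (p1 ++ s :: p2) with ((p1 ++ [s]) ++ p2) in *
      by now rewrite <- app_assoc.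
    apply Forall_app in hM as [hM _]. rewrite length_app.
    apply Nat.le_trans with (M * length (p1 ++ [s])); [|nia].
    clear h. unfold eLNDT_size, list_sum.
    induction hM as [|x l hx hM IH]; simpl in *; [lia|].
    rewrite Nat.mul_succ_r. lia.
Qed.

(** * Names of extension variables *)

(* [TF A] stands for A, [TTh l k] for "at least k members of l are true", and
   [TQ k Q b] for "Q has value b", where the negation of an atom A is read as
   "at least k of the other atoms are true". *)
Inductive task : Type :=
| TF : fml -> task
| TTh : list fml -> nat -> task
| TQ : nat -> query -> bool -> task.

(* A stack stands for the conjunction of its tasks and names an extension
   variable. The tail of the stack is what the 1-leaves of the head task
   continue with: this is how conjunction is expressed without negation. *)
Definition stack : Type := list task.

Lemma query_eq_dec (Q R : query) : {Q = R} + {Q <> R}.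
Proof. decide equality; apply fml_eq_dec. Defined.

Lemma stack_eq_dec (s t : stack) : {s = t} + {s <> t}.
Proof.
  apply list_eq_dec. decide equality;
    auto using fml_eq_dec, query_eq_dec, Nat.eq_dec, bool_dec, list_eq_dec.
Defined.

(** A defining formula of depth at most one whose variables are still stacks, so that closure and
    ranks can be settled before variables are numbered. As a formula it has size at most 3. *)
Inductive shape : Type :=
| Sh0 : shape
| Sh1 : shape
| ShV : stack -> shape
| ShOr : stack -> stack -> shape
| ShDec : stack -> nat -> stack -> shape.

Definition shape_children (h : shape) : list stack :=
  match h with
  | Sh0 | Sh1 => []
  | ShV s => [s]
  | ShOr s t | ShDec s _ t => [s; t]
  end.

Definition shape_app (h : shape) (c : stack) : shape :=
  match h with
  | Sh0 => Sh0
  | Sh1 => Sh1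
  | ShV s => ShV (s ++ c)
  | ShOr s t => ShOr (s ++ c) (t ++ c)
  | ShDec s p t => ShDec (s ++ c) p (t ++ c)
  end.

Definition shape_fml (idx : stack -> nat) (h : shape) : fml :=
  match h with
  | Sh0 => F0
  | Sh1 => F1
  | ShV s => FExt (idx s)
  | ShOr s t => FOr (FExt (idx s)) (FExt (idx t))
  | ShDec s p t => FDec (FExt (idx s)) p (FExt (idx t))
  end.

(** The list of atoms may contain a formula several times, and thresholds count with multiplicity;
    so a single occurrence is dropped. *)
Fixpoint remove_first (A : fml) (l : list fml) : list fml :=
  match l with
  | [] => []
  | B :: l => if fml_eq_dec A B then l else B :: remove_first A l
  end.

Fixpoint suffixes (l : list fml) : list (list fml) :=
  match l with
  | [] => [[]]
  | A :: l' => l :: suffixes l'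
  end.

Fixpoint subfmls (A : fml) : list fml :=
  A :: match A with
       | F0 | F1 | FExt _ => []
       | FDec B _ C | FOr B C => subfmls B ++ subfmls C
       end.

Fixpoint subqueries (Q : query) : list query :=
  Q :: match Q with
       | QF _ => []
       | QNeg R => subqueries R
       | QOr R R' | QAnd R R' => subqueries R ++ subqueries R'
       end.

Definition query_atom (Q : query) : list fml :=
  match Q with QF A => [A] | _ => [] end.

Fixpoint tree_queries (T : strategy) : list query :=
  match T with
  | SLeaf => []
  | SNode Q T0 T1 => Q :: tree_queries T0 ++ tree_queries T1
  end.

Fixpoint tree_paths (S : state) (T : strategy) : list state :=
  S :: match T with
       | SLeaf => []
       | SNode Q T0 T1 =>
           tree_paths ((Q, false) :: S) T0 ++ tree_paths ((Q, true) :: S) T1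
       end.

Lemma suffixes_refl l : In l (suffixes l).
Proof. destruct l; simpl; auto. Qed.

Lemma suffixes_cons A l l' : In (A :: l) (suffixes l') -> In l (suffixes l').
Proof.
  induction l' as [|B l' IH]; simpl.
  - intros [h|[]]; discriminate.
  - intros [h|h]; auto. injection h as -> ->. right; apply suffixes_refl.
Qed.

Lemma suffixes_incl l l' : In l (suffixes l') -> incl l l'.
Proof.
  induction l' as [|B l' IH]; simpl.
  - intros [<-|[]]. apply incl_refl.
  - intros [<-|h]; [apply incl_refl|]. now apply incl_tl, IH.
Qed.

Lemma remove_first_incl A l : incl (remove_first A l) l.
Proof.
  induction l as [|B l IH]; simpl; [easy|].
  destruct (fml_eq_dec A B); [apply incl_tl, incl_refl|].
  intros x [<-|h]; simpl; auto.
Qed.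

Lemma subfmls_refl A : In A (subfmls A).
Proof. destruct A; simpl; auto. Qed.

Lemma subfmls_trans A B C :
  In B (subfmls A) -> In C (subfmls B) -> In C (subfmls A).
Proof.
  induction A; simpl; intros [<-|h] hC; auto; try easy;
    apply in_app_or in h as [h|h]; right; apply in_or_app; auto.
Qed.

Lemma subqueries_refl Q : In Q (subqueries Q).
Proof. destruct Q; simpl; auto. Qed.

Lemma subqueries_trans P Q R :
  In Q (subqueries P) -> In R (subqueries Q) -> In R (subqueries P).
Proof.
  induction P; simpl; intros [<-|h] hC; auto; try easy;
    apply in_app_or in h as [h|h]; right; apply in_or_app; auto.
Qed.

Section Names.
Variables (E : axiom_list) (SQ : list query).

Definition atoms : list fml := flat_map query_atom SQ.

Definition stack_def (s : stack) : shape :=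
  match s with
  | [] => Sh1
  | TF F0 :: s => Sh0
  | TF F1 :: s => ShV s
  | TF (FDec A p B) :: s => ShDec (TF A :: s) p (TF B :: s)
  | TF (FOr A B) :: s => ShOr (TF A :: s) (TF B :: s)
  (* Variables without an axiom are treated as 0. *)
  | TF (FExt i) :: s => ShV (TF (nth i E F0) :: s)
  | TTh _ 0 :: s => ShV s
  | TTh [] (S _) :: s => Sh0
  | TTh (A :: l) (S k) :: s => ShOr (TTh l (S k) :: s) (TF A :: TTh l k :: s)
  | TQ k (QF A) true :: s => ShV (TF A :: s)
  | TQ k (QF A) false :: s => ShV (TTh (remove_first A atoms) k :: s)
  | TQ k (QNeg Q) b :: s => ShV (TQ k Q (negb b) :: s)
  | TQ k (QOr Q R) true :: s => ShOr (TQ k Q true :: s) (TQ k R true :: s)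
  | TQ k (QOr Q R) false :: s => ShV (TQ k Q false :: TQ k R false :: s)
  | TQ k (QAnd Q R) true :: s => ShV (TQ k Q true :: TQ k R true :: s)
  | TQ k (QAnd Q R) false :: s => ShOr (TQ k Q false :: s) (TQ k R false :: s)
  end.

(** Every clause of [stack_def] acts on the head task and keeps the tail as continuation, so a
    longer tail is merely carried along. The empty stack is different: its definition 1 would give
    way to that of [c]. *)
Lemma stack_def_app t c :
  t <> [] -> stack_def (t ++ c) = shape_app (stack_def t) c.
Proof.
  destruct t as [|a t]; [easy|intros _].
  destruct a as [[]|[|] []|k [] []]; reflexivity.
Qed.

Lemma shape_children_app h c u :
  In u (shape_children (shape_app h c)) ->
  exists v, In v (shape_children h) /\ u = v ++ c.
Proof.
  destruct h; simpl; try easy;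
    intuition (subst; eauto).
Qed.

(** * Closed finite sets of names *)

(** [F0] is present as the unfolding of variables without an axiom. *)
Definition base_fmls : list fml := F0 :: flat_map subfmls (E ++ atoms).

(** Unfolding a threshold shortens its list from the front, and the negation of an atom starts from
    [atoms] with that atom removed; these are the lists that arise, closed under tails. *)
Definition threshold_lists : list (list fml) :=
  suffixes atoms ++
  flat_map (fun A => map (remove_first A) (suffixes atoms)) atoms.

(** Thresholds go up to [length atoms + 1], one beyond [slices], because the last slice is bounded
    above by the refutable threshold. *)
Definition thresholds : list task :=
  flat_map (fun l => map (TTh l) (seq 0 (length atoms + 2))) threshold_lists.

Definition slices : list nat := seq 0 (length atoms + 1).

Definition single_tasks : list task :=
  map TF base_fmls ++ thresholds ++
  flat_map (fun k => flat_map (fun Q => [TQ k Q true; TQ k Q false]) SQ) slices.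

(** Two tasks suffice: a threshold puts one atom on top of a smaller threshold, and the atom is used
    up before that threshold unfolds again. *)
Definition threshold_stacks : list stack :=
  [] :: map (fun A => [TF A]) base_fmls ++ map (fun a => [a]) thresholds ++
  flat_map (fun A => map (fun a => [TF A; a]) thresholds) base_fmls.

(** For a conjunctive value the stacks of [Q] wait on top of the task of [R], followed by the stacks
    of [R] alone. Each subquery occurrence thus has a single continuation, and the number of stacks
    is linear in the query up to the factor from [threshold_stacks]. *)
Fixpoint query_stacks (k : nat) (Q : query) (b : bool) : list stack :=
  [TQ k Q b] ::
  match Q with
  | QF _ => threshold_stacks
  | QNeg Q => query_stacks k Q (negb b)
  | QOr Q R =>
      map (fun t => if b then t else t ++ [TQ k R b]) (query_stacks k Q b) ++
      query_stacks k R b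
  | QAnd Q R =>
      map (fun t => if b then t ++ [TQ k R b] else t) (query_stacks k Q b) ++
      query_stacks k R b
  end.

Definition prefix_stacks : list stack :=
  threshold_stacks ++
  flat_map (fun k => flat_map
    (fun Q => query_stacks k Q true ++ query_stacks k Q false) SQ) slices.

(** The additional last task [a] is there for the laws making [t ++ [a]] the conjunction of [t] and
    [[a]]; their proof unfolds [t] above a fixed [a]. *)
Definition all_stacks : list stack :=
  prefix_stacks ++
  flat_map (fun t => map (fun a => t ++ [a]) single_tasks) prefix_stacks.

Definition closed_stacks (l : list stack) : Prop :=
  forall t u, In t l -> In u (shape_children (stack_def t)) -> In u l.

Lemma base_fmls_sub A B :
  In A base_fmls -> In B (subfmls A) -> In B base_fmls.
Proof.
  unfold base_fmls. intros [<-|h] hB.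
  - destruct hB as [<-|[]]; simpl; auto.
  - right. apply in_flat_map in h as (C & h1 & h2). apply in_flat_map.
    exists C. split; auto. eapply subfmls_trans; eauto.
Qed.

Lemma base_fmls_dec A p B :
  In (FDec A p B) base_fmls -> In A base_fmls /\ In B base_fmls.
Proof.
  intros h; split; apply base_fmls_sub with (1 := h); simpl; right;
    apply in_or_app; auto using subfmls_refl.
Qed.

Lemma base_fmls_or A B :
  In (FOr A B) base_fmls -> In A base_fmls /\ In B base_fmls.
Proof.
  intros h; split; apply base_fmls_sub with (1 := h); simpl; right;
    apply in_or_app; auto using subfmls_refl.
Qed.

Lemma base_fmls_unfold i : In (nth i E F0) base_fmls.
Proof.
  destruct (nth_in_or_default i E F0) as [h|h].
  - right. apply in_flat_map. exists (nth i E F0).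
    split; [apply in_or_app; auto|apply subfmls_refl].
  - rewrite h. simpl; auto.
Qed.

Lemma base_fmls_atom A : In A atoms -> In A base_fmls.
Proof.
  intros h. right. apply in_flat_map. exists A.
  split; [apply in_or_app; auto|apply subfmls_refl].
Qed.

Lemma threshold_lists_suffix l :
  In l (suffixes atoms) -> In l threshold_lists.
Proof. intros; apply in_or_app; auto. Qed.

Lemma threshold_lists_remove A l :
  In A atoms -> In l (suffixes atoms) ->
  In (remove_first A l) threshold_lists.
Proof.
  intros hA hl. apply in_or_app; right. apply in_flat_map.
  exists A. split; auto. now apply in_map.
Qed.

Lemma threshold_lists_cons A l :
  In (A :: l) threshold_lists -> In A atoms /\ In l threshold_lists.
Proof.
  intros h. apply in_app_or in h as [h|h].
  - split.
    + apply (suffixes_incl _ _ h). simpl; auto.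
    + eapply threshold_lists_suffix, suffixes_cons, h.
  - apply in_flat_map in h as (B & hB & h).
    apply in_map_iff in h as (l' & e & h).
    split.
    + apply (suffixes_incl _ _ h), (remove_first_incl B). rewrite e.
      simpl; auto.
    + destruct l' as [|C l']; simpl in e; [discriminate|].
      apply suffixes_cons in h.
      destruct (fml_eq_dec B C).
      * subst l'. apply suffixes_cons in h. now apply threshold_lists_suffix.
      * injection e as -> <-. now apply threshold_lists_remove.
Qed.

Lemma in_thresholds l k :
  In l threshold_lists -> k <= length atoms + 1 -> In (TTh l k) thresholds.
Proof.
  intros h hk. apply in_flat_map. exists l. split; auto.
  apply in_map, in_seq. lia.
Qed.

Lemma thresholds_inv a :
  In a thresholds ->
  exists l k, a = TTh l k /\ In l threshold_lists /\ k <= length atoms + 1.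
Proof.
  intros h. apply in_flat_map in h as (l & h1 & h2).
  apply in_map_iff in h2 as (k & <- & h2). apply in_seq in h2.
  exists l, k. repeat split; auto. lia.
Qed.

Lemma threshold_stacks_fml A :
  In A base_fmls -> In [TF A] threshold_stacks.
Proof.
  intros h. right. apply in_or_app; left. now apply (in_map (fun A => [TF A])).
Qed.

Lemma threshold_stacks_threshold a :
  In a thresholds -> In [a] threshold_stacks.
Proof.
  intros h. right. apply in_or_app; right. apply in_or_app; left.
  now apply (in_map (fun a => [a])).
Qed.

Lemma threshold_stacks_pair A a :
  In A base_fmls -> In a thresholds -> In [TF A; a] threshold_stacks.
Proof.
  intros hA ha. right. apply in_or_app; right. apply in_or_app; right.
  apply in_flat_map. exists A. split; auto.
  now apply (in_map (fun a => [TF A; a])).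
Qed.

Lemma threshold_stacks_inv t :
  In t threshold_stacks ->
  t = [] \/ (exists A, In A base_fmls /\ t = [TF A]) \/
  (exists a, In a thresholds /\ t = [a]) \/
  (exists A a, In A base_fmls /\ In a thresholds /\ t = [TF A; a]).
Proof.
  intros [<-|h]; auto. right.
  apply in_app_or in h as [h|h]; [|apply in_app_or in h as [h|h]].
  - apply in_map_iff in h as (A & <- & h). eauto.
  - apply in_map_iff in h as (A & <- & h). eauto.
  - apply in_flat_map in h as (A & hA & h).
    apply in_map_iff in h as (a & <- & h). right; right; eauto 6.
Qed.

Lemma threshold_stacks_closed : closed_stacks threshold_stacks.
Proof.
  assert (hf : forall A u s, In A base_fmls ->
    In u (shape_children (stack_def (TF A :: s))) ->
    u = s \/ exists B, In B base_fmls /\ u = TF B :: s).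
  { intros A u s hA hu. destruct A as [| |B p C|B C|i]; cbn -[nth] in hu.
    - easy.
    - left. now destruct hu as [<-|[]].
    - apply base_fmls_dec in hA. right.
      destruct hu as [<-|[<-|[]]]; eexists; split; [|reflexivity| |reflexivity];
        tauto.
    - apply base_fmls_or in hA. right.
      destruct hu as [<-|[<-|[]]]; eexists; split; [|reflexivity| |reflexivity];
        tauto.
    - right. destruct hu as [<-|[]]. eexists; split; [|reflexivity].
      apply base_fmls_unfold. }
  intros t u ht hu.
  apply threshold_stacks_inv in ht
    as [->|[(A & hA & ->)|[(a & ha & ->)|(A & a & hA & ha & ->)]]].
  - easy.
  - destruct (hf _ _ _ hA hu) as [->|(B & hB & ->)]; [simpl; auto|].
    now apply threshold_stacks_fml.
  - apply thresholds_inv in ha as (l & k & -> & hl & hk).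
    destruct l as [|A l], k as [|k]; cbn in hu; try easy.
    + destruct hu as [<-|[]]. simpl; auto.
    + destruct hu as [<-|[]]. simpl; auto.
    + apply threshold_lists_cons in hl as [hA hl].
      destruct hu as [<-|[<-|[]]].
      * apply threshold_stacks_threshold, in_thresholds; auto.
      * apply threshold_stacks_pair; [now apply base_fmls_atom|].
        apply in_thresholds; auto. lia.
  - destruct (hf _ _ _ hA hu) as [->|(B & hB & ->)].
    + now apply threshold_stacks_threshold.
    + now apply threshold_stacks_pair.
Qed.

Lemma query_stacks_refl k Q b : In [TQ k Q b] (query_stacks k Q b).
Proof. destruct Q; simpl; auto. Qed.

Lemma SQ_atom A : In (QF A) SQ -> In A atoms.
Proof.
  intros h. apply in_flat_map. exists (QF A). simpl; auto.
Qed.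

Hypothesis SQ_closed : forall Q R, In Q SQ -> In R (subqueries Q) -> In R SQ.

Lemma SQ_neg Q : In (QNeg Q) SQ -> In Q SQ.
Proof.
  intros h. apply SQ_closed with (1 := h). simpl; auto using subqueries_refl.
Qed.

Lemma SQ_or Q R : In (QOr Q R) SQ -> In Q SQ /\ In R SQ.
Proof.
  intros h. split; apply SQ_closed with (1 := h); simpl; right;
    apply in_or_app; auto using subqueries_refl.
Qed.

Lemma SQ_and Q R : In (QAnd Q R) SQ -> In Q SQ /\ In R SQ.
Proof.
  intros h. split; apply SQ_closed with (1 := h); simpl; right;
    apply in_or_app; auto using subqueries_refl.
Qed.

(** A step inside a nonempty [t] leaves [c] at the bottom; an exhausted [t] falls through to [[c]],
    which belongs to [l']. *)
Lemma closed_stacks_snoc l l' c t u :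
  closed_stacks l -> closed_stacks l' -> In [c] l' -> In t l ->
  In u (shape_children (stack_def (t ++ [c]))) ->
  In u (map (fun t => t ++ [c]) l ++ l').
Proof.
  intros hl hl' hc ht hu. apply in_or_app.
  destruct t as [|a t].
  - right. simpl in hu. now apply hl' with [c].
  - left. rewrite stack_def_app in hu by easy.
    apply shape_children_app in hu as (v & hv & ->).
    apply (in_map (fun t => t ++ [c])). now apply hl with (a :: t).
Qed.

Lemma query_stacks_closed k Q :
  k <= length atoms -> In Q SQ -> forall b, closed_stacks (query_stacks k Q b).
Proof.
  intros hk. induction Q as [A|Q IH|Q IHQ R IHR|Q IHQ R IHR]; intros hQ b t u.
  - apply SQ_atom in hQ. intros [<-|ht] hu.
    + right. destruct b; destruct hu as [<-|[]].
      * apply threshold_stacks_fml. now apply base_fmls_atom.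
      * apply threshold_stacks_threshold, in_thresholds; [|lia].
        apply threshold_lists_remove; auto using suffixes_refl.
    + right. now apply threshold_stacks_closed with t.
  - apply SQ_neg in hQ. intros [<-|ht] hu; right.
    + destruct hu as [<-|[]]. apply query_stacks_refl.
    + now apply (IH hQ) with t.
  - apply SQ_or in hQ as [hQ hR]. intros [<-|ht] hu; right.
    + destruct b; cbn in hu.
      * rewrite map_id. destruct hu as [<-|[<-|[]]]; apply in_or_app;
          auto using query_stacks_refl.
      * destruct hu as [<-|[]]. apply in_or_app; left.
        apply in_map_iff. exists [TQ k Q false]. split; auto.
        apply query_stacks_refl.
    + destruct b.
      * rewrite map_id in *. apply in_app_or in ht as [ht|ht];
          apply in_or_app; [left; now apply (IHQ hQ) with t|].
        right; now apply (IHR hR) with t.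
      * apply in_app_or in ht as [ht|ht].
        -- apply in_map_iff in ht as (t' & <- & ht).
           apply closed_stacks_snoc with t'; auto using query_stacks_refl.
        -- apply in_or_app; right; now apply (IHR hR) with t.
  - apply SQ_and in hQ as [hQ hR]. intros [<-|ht] hu; right.
    + destruct b; cbn in hu.
      * destruct hu as [<-|[]]. apply in_or_app; left.
        apply in_map_iff. exists [TQ k Q true]. split; auto.
        apply query_stacks_refl.
      * rewrite map_id. destruct hu as [<-|[<-|[]]]; apply in_or_app;
          auto using query_stacks_refl.
    + destruct b.
      * apply in_app_or in ht as [ht|ht].
        -- apply in_map_iff in ht as (t' & <- & ht).
           apply closed_stacks_snoc with t'; auto using query_stacks_refl.
        -- apply in_or_app; right; now apply (IHR hR) with t.
      * rewrite map_id in *. apply in_app_or in ht as [ht|ht];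
          apply in_or_app; [left; now apply (IHQ hQ) with t|].
        right; now apply (IHR hR) with t.
Qed.

Lemma in_slices k : In k slices <-> k <= length atoms.
Proof. unfold slices. rewrite in_seq. lia. Qed.

Lemma prefix_stacks_query k Q b t :
  k <= length atoms -> In Q SQ -> In t (query_stacks k Q b) ->
  In t prefix_stacks.
Proof.
  intros hk hQ ht. apply in_or_app; right. apply in_flat_map.
  exists k. split; [now apply in_slices|]. apply in_flat_map.
  exists Q. split; auto. apply in_or_app. destruct b; auto.
Qed.

Lemma prefix_stacks_closed : closed_stacks prefix_stacks.
Proof.
  intros t u ht hu. apply in_app_or in ht as [ht|ht].
  - apply in_or_app; left. now apply threshold_stacks_closed with t.
  - apply in_flat_map in ht as (k & hk & ht). apply in_slices in hk.
    apply in_flat_map in ht as (Q & hQ & ht).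
    apply in_app_or in ht as [ht|ht];
      eapply prefix_stacks_query; eauto; eapply query_stacks_closed; eauto.
Qed.

Lemma single_tasks_prefix a : In a single_tasks -> In [a] prefix_stacks.
Proof.
  intros h. apply in_app_or in h as [h|h]; [|apply in_app_or in h as [h|h]].
  - apply in_map_iff in h as (A & <- & h). apply in_or_app; left.
    now apply threshold_stacks_fml.
  - apply in_or_app; left. now apply threshold_stacks_threshold.
  - apply in_flat_map in h as (k & hk & h). apply in_slices in hk.
    apply in_flat_map in h as (Q & hQ & [<-|[<-|[]]]);
      eapply prefix_stacks_query; eauto using query_stacks_refl.
Qed.

Lemma single_tasks_query k Q b :
  k <= length atoms -> In Q SQ -> In (TQ k Q b) single_tasks.
Proof.
  intros hk hQ. apply in_or_app; right. apply in_or_app; right.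
  apply in_flat_map. exists k. split; [now apply in_slices|].
  apply in_flat_map. exists Q. split; auto. destruct b; simpl; auto.
Qed.

Lemma single_tasks_threshold l k :
  In l threshold_lists -> k <= length atoms + 1 -> In (TTh l k) single_tasks.
Proof.
  intros hl hk. apply in_or_app; right. apply in_or_app; left.
  now apply in_thresholds.
Qed.

Lemma single_tasks_fml A : In A base_fmls -> In (TF A) single_tasks.
Proof. intros h. apply in_or_app; left. now apply in_map. Qed.

Lemma all_stacks_prefix t : In t prefix_stacks -> In t all_stacks.
Proof. intros; apply in_or_app; auto. Qed.

Lemma all_stacks_snoc t a :
  In t prefix_stacks -> In a single_tasks -> In (t ++ [a]) all_stacks.
Proof.
  intros ht ha. apply in_or_app; right. apply in_flat_map.
  exists t. split; auto. now apply (in_map (fun a => t ++ [a])).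
Qed.

Lemma all_stacks_closed : closed_stacks all_stacks.
Proof.
  intros t u ht hu. apply in_app_or in ht as [ht|ht].
  - apply all_stacks_prefix. now apply prefix_stacks_closed with t.
  - apply in_flat_map in ht as (t' & ht & h).
    apply in_map_iff in h as (a & <- & ha).
    destruct t' as [|c t'].
    + apply all_stacks_prefix, prefix_stacks_closed with [a]; auto.
      now apply single_tasks_prefix.
    + rewrite stack_def_app in hu by easy.
      apply shape_children_app in hu as (v & hv & ->).
      apply all_stacks_snoc; auto. now apply prefix_stacks_closed with (c :: t').
Qed.

(** * Ranks *)

Variable W : nat.
Hypothesis W_ge : 2 <= W.
Hypothesis W_size : forall A, In A E -> fml_size A < W.
Hypothesis E_wf : ext_axioms E.

(** A weight in base [W]: an axiom [E_i] has fewer than [W] symbols and only variables below [i], so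
    its rank is at most [fml_size E_i * W ^ i], which is less than [W ^ S i]. Unfolding a variable
    therefore lowers the rank. *)
Fixpoint fml_rank (A : fml) : nat :=
  match A with
  | F0 | F1 => 1
  | FDec B _ C | FOr B C => fml_rank B + 1 + fml_rank C
  | FExt i => W ^ S i
  end.

Lemma fml_rank_pos A : 1 <= fml_rank A.
Proof.
  induction A; simpl; try lia.
  pose proof (Nat.pow_nonzero W n). nia.
Qed.

Lemma fml_rank_bound i A :
  ext_vars_below i A -> fml_rank A <= fml_size A * W ^ i.
Proof.
  assert (1 <= W ^ i) by (pose proof (Nat.pow_nonzero W i); lia).
  induction A as [| |B IHB p C IHC|B IHB C IHC|j];
    cbn [fml_rank fml_size ext_vars_below]; intros h; try lia;
    try (destruct h as [hB hC]; specialize (IHB hB); specialize (IHC hC); nia).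
  rewrite Nat.mul_1_l. apply Nat.pow_le_mono_r; lia.
Qed.

Lemma fml_rank_unfold i : fml_rank (nth i E F0) < fml_rank (FExt i).
Proof.
  cbn [fml_rank].
  destruct (nth_error E i) as [A|] eqn:e.
  - rewrite (nth_error_nth _ _ _ e).
    pose proof (fml_rank_bound i A (E_wf _ _ e)).
    pose proof (W_size A (nth_error_In _ _ e)).
    assert (1 <= W ^ i) by (pose proof (Nat.pow_nonzero W i); lia).
    rewrite Nat.pow_succ_r'. nia.
  - rewrite nth_overflow by now apply nth_error_None. cbn [fml_rank].
    assert (1 <= W ^ i) by (pose proof (Nat.pow_nonzero W i); lia).
    rewrite Nat.pow_succ_r'. nia.
Qed.

Fixpoint threshold_rank (l : list fml) : nat :=
  match l with
  | [] => 1
  | A :: l => fml_rank A + 1 + threshold_rank l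
  end.

Lemma threshold_rank_pos l : 1 <= threshold_rank l.
Proof. induction l; simpl; lia. Qed.

Lemma threshold_rank_remove_first A l :
  threshold_rank (remove_first A l) <= threshold_rank l.
Proof.
  induction l as [|B l IH]; simpl; [lia|].
  destruct (fml_eq_dec A B); simpl; lia.
Qed.

(** An atom pays for both of its translations: the formula itself for the value true, and a
    threshold over a sublist of [atoms] for the value false. *)
Fixpoint query_rank (Q : query) : nat :=
  match Q with
  | QF A => fml_rank A + 1 + threshold_rank atoms
  | QNeg Q => query_rank Q + 1
  | QOr Q R | QAnd Q R => query_rank Q + 1 + query_rank R
  end.

Lemma query_rank_pos Q : 1 <= query_rank Q.
Proof. induction Q; simpl; lia. Qed.

Definition task_rank (a : task) : nat :=
  match a with
  | TF A => fml_rank A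
  | TTh l _ => threshold_rank l
  | TQ _ Q _ => query_rank Q
  end.

Fixpoint stack_rank (s : stack) : nat :=
  match s with
  | [] => 0
  | a :: s => task_rank a + stack_rank s
  end.

Lemma stack_def_rank s u :
  In u (shape_children (stack_def s)) -> stack_rank u < stack_rank s.
Proof.
  destruct s as [|[A|l k|k Q b] s]; [easy|..].
  - destruct A as [| |B p C|B C|i]; cbn -[nth Nat.pow];
      intuition (subst; cbn -[nth Nat.pow]); try lia;
      try (pose proof (fml_rank_pos B); pose proof (fml_rank_pos C); lia).
    pose proof (fml_rank_unfold i). cbn -[nth Nat.pow] in *. lia.
  - destruct l as [|B l], k as [|k]; cbn;
      intuition (subst; cbn); try lia.
  - destruct Q as [A|Q|Q R|Q R], b; cbn; intuition (subst; cbn); try lia;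
      try (pose proof (threshold_rank_pos atoms));
      try (pose proof (fml_rank_pos A));
      try (pose proof (threshold_rank_remove_first A atoms));
      try (pose proof (query_rank_pos Q));
      try (pose proof (query_rank_pos R)); lia.
Qed.

End Names.

(** * Derivations of the key sequents *)

Ltac member :=
  solve [repeat first [simple apply in_eq | assumption | simple apply in_cons]].
Ltac included := repeat (apply incl_cons; [member|]); apply incl_nil_l.
Ltac leaf :=
  match goal with
  | H : basic_sequent _ _ _ |- cut_tree _ _ _ _ _ _ =>
      solve [apply (ct_basic _ _ _ _ _ _ _ _ H); included]
  | H : generated _ _ _ _ (_, _) |- cut_tree _ _ _ _ _ _ =>
      solve [apply (ct_key _ _ _ _ _ _ _ _ H); included]
  end.
(* Cut on the formulas [fs] in turn, closing each branch as soon as it contains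
   the formulas of an available sequent. *)
Ltac cuts fs :=
  first
    [ leaf
    | lazymatch fs with
      | cons ?f ?fs' =>
          lazymatch goal with
          | |- cut_tree ?E _ _ _ _ _ => pose proof (bs_id E f)
          end;
          apply (ct_cut _ _ _ _ f);
          [cbn [fml_size pvar]; lia | cuts fs' | cuts fs']
      end ].
Ltac or_sequents E A B :=
  pose proof (bs_orR0 E A B); pose proof (bs_orR1 E A B);
  pose proof (bs_orL E A B).
Ltac dec_sequents E A p B :=
  pose proof (bs_decR0 E A p B); pose proof (bs_decR1 E A p B);
  pose proof (bs_decL0 E A p B); pose proof (bs_decL1 E A p B).

Lemma cut_tree_le E z H n n' G D :
  cut_tree E z H n G D -> n <= n' -> cut_tree E z H n' G D.
Proof.
  intros h. revert n'.
  induction h as [n G0 D0 G D h1 h2 h3|n G0 D0 G D h1 h2 h3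
                 |n A G D hA h1 IH1 h2 IH2]; intros n' hn.
  - eapply ct_basic; eauto.
  - eapply ct_key; eauto.
  - destruct n' as [|n']; [lia|]. apply ct_cut with A; auto with arith.
Qed.

Lemma cut_tree_weakening E z H n G D G' D' :
  incl G G' -> incl D D' -> cut_tree E z H n G D -> cut_tree E z H n G' D'.
Proof.
  intros hG hD h. revert G' D' hG hD.
  induction h as [n G0 D0 G D h1 h2 h3|n G0 D0 G D h1 h2 h3
                 |n A G D hA h1 IH1 h2 IH2]; intros G' D' hG hD.
  - eapply ct_basic; eauto using incl_tran.
  - eapply ct_key; eauto using incl_tran.
  - apply ct_cut with A; auto.
    + apply IH1; auto. intros x [<-|hx]; simpl; auto.
    + apply IH2; auto. intros x [<-|hx]; simpl; auto.
Qed.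

Section Keys.
Variables (E : axiom_list) (SQ : list query) (Gm Dl : list fml).
Variables (T : strategy) (E' : axiom_list) (idx : stack -> nat) (z W : nat).

Notation L := (atoms SQ).
Notation nm s := (FExt (idx s)).
Notation threshold k := (nm [TTh L k]).
Notation value k Q b := (nm [TQ k Q b]).

(** Only the answers given during play are translated. The initial assignments remain as [Gm] and
    [Dl], so that the sequents of the root combine directly to the goal. *)
Definition node_sequent (k : nat) (S : state) : sequent :=
  (threshold k :: map (fun a => value k (fst a) (snd a)) S ++ Gm,
   threshold (Datatypes.S k) :: Dl).

(** This delimits the candidates to be counted and does not claim that they are provable: [key_sim]
    admits pairs without a simulation and [key_empty] admits small thresholds. Which of them are
    derived is recorded by [proved]. *)
Inductive key : sequent -> Prop :=
| key_sim A B :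
    In A (base_fmls E SQ) -> In B (base_fmls E SQ) -> key ([B], [A])
| key_split0 t a :
    In t (prefix_stacks E SQ) -> In a (single_tasks E SQ) ->
    key ([nm (t ++ [a])], [nm t])
| key_split1 t a :
    In t (prefix_stacks E SQ) -> In a (single_tasks E SQ) ->
    key ([nm (t ++ [a])], [nm [a]])
| key_join t a :
    In t (prefix_stacks E SQ) -> In a (single_tasks E SQ) ->
    key ([nm t; nm [a]], [nm (t ++ [a])])
| key_baseL A : In A (base_fmls E SQ) -> key ([nm [TF A]], [A])
| key_baseR A : In A (base_fmls E SQ) -> key ([A], [nm [TF A]])
| key_up A l k :
    In A L -> In l (suffixes L) -> k <= length L ->
    key ([A; nm [TTh (remove_first A l) k]], [nm [TTh l (S k)]])
| key_down A l k :
    In A L -> In l (suffixes L) -> k <= length L + 1 ->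
    key ([nm [TTh l k]], [A; nm [TTh (remove_first A l) k]])
| key_empty l k :
    In l (suffixes L) -> k <= length L + 1 -> key ([nm [TTh l k]], [])
| key_complete k Q :
    k <= length L -> In Q SQ ->
    key ([threshold k], [value k Q true; value k Q false])
| key_consistent k Q :
    k <= length L -> In Q SQ ->
    key ([value k Q true; value k Q false], [threshold (S k)])
| key_node k S : k <= length L -> In S (tree_paths [] T) -> key (node_sequent k S)
| key_chain k : k <= length L + 1 -> key (Gm, threshold k :: Dl)
| key_goal : key (Gm, Dl).

Hypothesis W_ge : 2 <= W.
Hypothesis W_size : forall A, In A E -> fml_size A < W.
Hypothesis E_wf : ext_axioms E.
Hypothesis SQ_cl : forall Q R, In Q SQ -> In R (subqueries Q) -> In R SQ.
Hypothesis idx_def : forall s, In s (all_stacks E SQ) ->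
  in_axioms E' (idx s) (shape_fml idx (stack_def E SQ s)).
Hypothesis base_def : forall i, In (FExt i) (base_fmls E SQ) ->
  in_axioms E' i (nth i E F0).
Hypothesis z_base : forall A, In A (base_fmls E SQ) -> fml_size A <= z.
Hypothesis z_ge : 3 <= z.
Hypothesis Gm_SQ : forall A, In A Gm -> In (QF A) SQ.
Hypothesis Dl_SQ : forall A, In A Dl -> In (QF A) SQ.
Hypothesis T_SQ : forall Q, In Q (tree_queries T) -> In Q SQ.

(** A uniform depth with some slack: the longest case distinction below has nine cut formulas, and a
    leaf of the strategy takes at most [4 + 8] cuts. *)
Notation proved := (generated E' z key 16).

Lemma stack_unfold s :
  In s (all_stacks E SQ) ->
  basic_sequent E' [nm s] [shape_fml idx (stack_def E SQ s)].
Proof. intros h. apply bs_unfold. auto. Qed.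

Lemma stack_fold s :
  In s (all_stacks E SQ) ->
  basic_sequent E' [shape_fml idx (stack_def E SQ s)] [nm s].
Proof. intros h. apply bs_fold. auto. Qed.

Ltac stack_sequents s h :=
  let h1 := fresh in let h2 := fresh in
  pose proof (stack_unfold s h) as h1; pose proof (stack_fold s h) as h2;
  cbn [stack_def shape_fml negb] in h1, h2.

Lemma nil_stack : In [] (all_stacks E SQ).
Proof. apply all_stacks_prefix. simpl; auto. Qed.

Lemma single_stack a : In a (single_tasks E SQ) -> In [a] (all_stacks E SQ).
Proof. intros h. now apply all_stacks_prefix, single_tasks_prefix. Qed.

(** Every clause of the simulation is sound as an implication from [B] to [A]. All pairs met consist
    of base formulas, so a large simulation derivation still visits only polynomially many
    sequents. *)
Lemma simulates_key A B :
  simulates E A B -> In A (base_fmls E SQ) -> In B (base_fmls E SQ) ->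
  proved ([B], [A]).
Proof.
  pose proof bs_id as Hid.
  assert (ax : forall i X, in_axioms E i X -> X = nth i E F0).
  { intros i X h. symmetry. now apply nth_error_nth. }
  intros h. induction h as [A|A C D h1 IH1 h2 IH2|A i Ei hi h IH
    |A p B C D h1 IH1 h2 IH2|A0 A1 B h IH|A0 A1 B h IH|i Ei B hi h IH];
    intros hA hB; pose proof (z_base _ hA); pose proof (z_base _ hB);
    (apply generated_intro; [now constructor|]).
  - specialize (Hid E' A). cuts (@nil fml).
  - pose proof (base_fmls_or _ _ _ _ hB) as [hC hD].
    specialize (IH1 hA hC). specialize (IH2 hA hD). or_sequents E' C D.
    pose proof (z_base _ hC). pose proof (z_base _ hD).
    cuts [C; D].
  - pose proof (base_fmls_unfold E SQ i) as hi'.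
    pose proof (base_def i hB) as hd.
    rewrite <- (ax _ _ hi) in *. specialize (IH hA hi').
    pose proof (bs_unfold E' _ _ hd). pose proof (z_base _ hi').
    cuts [Ei].
  - pose proof (base_fmls_dec _ _ _ _ _ hA) as [hA' hB'].
    pose proof (base_fmls_dec _ _ _ _ _ hB) as [hC' hD'].
    specialize (IH1 hA' hC'). specialize (IH2 hB' hD').
    pose proof (z_base _ hA'). pose proof (z_base _ hB').
    pose proof (z_base _ hC'). pose proof (z_base _ hD').
    dec_sequents E' A p B. dec_sequents E' C p D.
    cuts [pvar p; C; D; A; B].
  - pose proof (base_fmls_or _ _ _ _ hA) as [hA0 hA1].
    specialize (IH hA0 hB). or_sequents E' A0 A1. pose proof (z_base _ hA0).
    cuts [A0].
  - pose proof (base_fmls_or _ _ _ _ hA) as [hA0 hA1].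
    specialize (IH hA1 hB). or_sequents E' A0 A1. pose proof (z_base _ hA1).
    cuts [A1].
  - pose proof (base_fmls_unfold E SQ i) as hi'.
    pose proof (base_def i hA) as hd.
    rewrite <- (ax _ _ hi) in *. specialize (IH hi' hB).
    pose proof (bs_fold E' _ _ hd). pose proof (z_base _ hi').
    cuts [Ei].
Qed.

(** The conjunction laws, by induction on the rank of [t]. The names [t] and [t ++ [a]] unfold in
    parallel to shapes that differ only by [a] at the end of the children; when [t] is used up it is
    the constant 1 and [t ++ [a]] is [[a]] itself. *)
Lemma split_keys a : In a (single_tasks E SQ) -> forall n t,
  stack_rank SQ W t < n -> In t (prefix_stacks E SQ) ->
  proved ([nm (t ++ [a])], [nm t]) /\
  proved ([nm (t ++ [a])], [nm [a]]) /\
  proved ([nm t; nm [a]], [nm (t ++ [a])]).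
Proof.
  intros ha. induction n as [|n IH]; [easy|]. intros t hr ht.
  pose proof (all_stacks_snoc _ _ _ _ ht ha) as hta.
  pose proof (all_stacks_prefix _ _ _ ht) as ht'.
  destruct t as [|c t].
  - stack_sequents (@nil task) nil_stack. pose proof (bs_1 E').
    pose proof (bs_id E' (nm [a])).
    repeat split; (apply generated_intro; [now constructor|]); cbn [app];
      cuts [F1].
  - pose proof (stack_unfold _ ht') as u1. pose proof (stack_fold _ ht') as f1.
    pose proof (stack_unfold _ hta) as u2. pose proof (stack_fold _ hta) as f2.
    rewrite stack_def_app in u2, f2 by easy.
    assert (IH' : forall u, In u (shape_children (stack_def E SQ (c :: t))) ->
      proved ([nm (u ++ [a])], [nm u]) /\
      proved ([nm (u ++ [a])], [nm [a]]) /\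
      proved ([nm u; nm [a]], [nm (u ++ [a])])).
    { intros u hu. apply IH.
      - pose proof (stack_def_rank E SQ W W_ge W_size E_wf _ _ hu). lia.
      - now apply prefix_stacks_closed with (c :: t). }
    (* A nonempty stack defined as 1 would discard [a]; only the empty stack has this definition. *)
    assert (h1 : stack_def E SQ (c :: t) <> Sh1)
      by (destruct c as [[]|[|] []|k [] []]; discriminate).
    set (s := c :: t) in *. clearbody s. clear IH.
    destruct (stack_def E SQ s) as [| |u|u v|u p v];
      cbn [shape_fml shape_app shape_children] in *.
    + pose proof (bs_0 E').
      repeat split; (apply generated_intro; [now constructor|]); cuts [F0].
    + easy.
    + destruct (IH' u) as (k1 & k2 & k3); [simpl; auto|].
      repeat split; (apply generated_intro; [now constructor|]);
        cuts [nm (u ++ [a]); nm u; nm [a]].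
    + destruct (IH' u) as (k1 & k2 & k3); [simpl; auto|].
      destruct (IH' v) as (k4 & k5 & k6); [simpl; auto|].
      or_sequents E' (nm u) (nm v). or_sequents E' (nm (u ++ [a])) (nm (v ++ [a])).
      repeat split; (apply generated_intro; [now constructor|]).
      * cuts [FOr (nm (u ++ [a])) (nm (v ++ [a])); nm (u ++ [a]); nm (v ++ [a]);
          nm u; nm v; FOr (nm u) (nm v)].
      * cuts [FOr (nm (u ++ [a])) (nm (v ++ [a])); nm (u ++ [a]); nm (v ++ [a])].
      * cuts [FOr (nm u) (nm v); nm u; nm v; nm (u ++ [a]); nm (v ++ [a]);
          FOr (nm (u ++ [a])) (nm (v ++ [a]))].
    + destruct (IH' u) as (k1 & k2 & k3); [simpl; auto|].
      destruct (IH' v) as (k4 & k5 & k6); [simpl; auto|].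
      dec_sequents E' (nm u) p (nm v).
      dec_sequents E' (nm (u ++ [a])) p (nm (v ++ [a])).
      repeat split; (apply generated_intro; [now constructor|]).
      * cuts [FDec (nm (u ++ [a])) p (nm (v ++ [a])); pvar p;
          nm (u ++ [a]); nm (v ++ [a]); nm u; nm v; FDec (nm u) p (nm v)].
      * cuts [FDec (nm (u ++ [a])) p (nm (v ++ [a])); pvar p;
          nm (u ++ [a]); nm (v ++ [a])].
      * cuts [FDec (nm u) p (nm v); pvar p; nm u; nm v;
          nm (u ++ [a]); nm (v ++ [a]); FDec (nm (u ++ [a])) p (nm (v ++ [a]))].
Qed.

Lemma split_key0 t a :
  In t (prefix_stacks E SQ) -> In a (single_tasks E SQ) ->
  proved ([nm (t ++ [a])], [nm t]).
Proof.
  intros ht ha. now apply (split_keys a ha (S (stack_rank SQ W t))); auto.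
Qed.

Lemma split_key1 t a :
  In t (prefix_stacks E SQ) -> In a (single_tasks E SQ) ->
  proved ([nm (t ++ [a])], [nm [a]]).
Proof.
  intros ht ha. now apply (split_keys a ha (S (stack_rank SQ W t))); auto.
Qed.

Lemma join_key t a :
  In t (prefix_stacks E SQ) -> In a (single_tasks E SQ) ->
  proved ([nm t; nm [a]], [nm (t ++ [a])]).
Proof.
  intros ht ha. now apply (split_keys a ha (S (stack_rank SQ W t))); auto.
Qed.

Ltac pair_sequents a c ha hc :=
  pose proof (split_key0 [a] c (single_tasks_prefix _ _ _ ha) hc);
  pose proof (split_key1 [a] c (single_tasks_prefix _ _ _ ha) hc);
  pose proof (join_key [a] c (single_tasks_prefix _ _ _ ha) hc);
  cbn [app] in *.

(** The induction is on rank, not on structure, because the case of an extension variable continues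
    with its axiom. The copy of [A] made of names and [A] itself unfold in step. *)
Lemma base_keys n : forall A,
  fml_rank W A < n -> In A (base_fmls E SQ) ->
  proved ([nm [TF A]], [A]) /\ proved ([A], [nm [TF A]]).
Proof.
  induction n as [|n IH]; [easy|]. intros A hr hA.
  pose proof (z_base _ hA).
  stack_sequents [TF A] (single_stack _ (single_tasks_fml _ _ _ hA)).
  stack_sequents (@nil task) nil_stack.
  destruct A as [| |B p C|B C|i]; cbn [stack_def shape_fml] in *.
  - pose proof (bs_0 E').
    split; (apply generated_intro; [now constructor|]); cuts [F0].
  - pose proof (bs_1 E').
    split; (apply generated_intro; [now constructor|]); cuts [F1; nm []].
  - pose proof (base_fmls_dec _ _ _ _ _ hA) as [hB hC].
    cbn [fml_rank] in hr.
    destruct (IH B) as [k1 k2]; [lia|auto|].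
    destruct (IH C) as [k3 k4]; [lia|auto|].
    pose proof (z_base _ hB). pose proof (z_base _ hC).
    dec_sequents E' B p C. dec_sequents E' (nm [TF B]) p (nm [TF C]).
    split; (apply generated_intro; [now constructor|]);
      cuts [FDec (nm [TF B]) p (nm [TF C]); pvar p; nm [TF B]; nm [TF C]; B; C].
  - pose proof (base_fmls_or _ _ _ _ hA) as [hB hC].
    cbn [fml_rank] in hr.
    destruct (IH B) as [k1 k2]; [lia|auto|].
    destruct (IH C) as [k3 k4]; [lia|auto|].
    pose proof (z_base _ hB). pose proof (z_base _ hC).
    or_sequents E' B C. or_sequents E' (nm [TF B]) (nm [TF C]).
    split; (apply generated_intro; [now constructor|]);
      cuts [FOr (nm [TF B]) (nm [TF C]); nm [TF B]; nm [TF C]; B; C].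
  - pose proof (base_def i hA) as hd.
    pose proof (base_fmls_unfold E SQ i) as hi.
    pose proof (fml_rank_unfold E W W_ge W_size E_wf i).
    destruct (IH (nth i E F0)) as [k1 k2]; [lia|auto|].
    pose proof (z_base _ hi).
    set (X := nth i E F0) in *. clearbody X.
    pose proof (bs_unfold E' _ _ hd). pose proof (bs_fold E' _ _ hd).
    split; (apply generated_intro; [now constructor|]);
      cuts [nm [TF X]; X].
Qed.

Lemma base_keyL A : In A (base_fmls E SQ) -> proved ([nm [TF A]], [A]).
Proof. intros h. now apply (base_keys (S (fml_rank W A))); auto. Qed.

Lemma base_keyR A : In A (base_fmls E SQ) -> proved ([A], [nm [TF A]]).
Proof. intros h. now apply (base_keys (S (fml_rank W A))); auto. Qed.

Lemma threshold_zero l :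
  In l (threshold_lists SQ) ->
  basic_sequent E' [nm []] [nm [TTh l 0]] /\
  basic_sequent E' [nm [TTh l 0]] [nm []] /\
  basic_sequent E' [F1] [nm []] /\ basic_sequent E' [] [F1].
Proof.
  intros hl.
  assert (hs : In (TTh l 0) (single_tasks E SQ))
    by (apply single_tasks_threshold; auto; lia).
  stack_sequents [TTh l 0] (single_stack _ hs).
  stack_sequents (@nil task) nil_stack.
  destruct l; repeat split; try assumption; apply bs_1.
Qed.

(** Induction down to the first occurrence of [A]. There the claim is one unfolding of the
    threshold; before it, the full and the reduced list have the same head [B] and are unfolded
    simultaneously. *)
Lemma threshold_keys A l :
  In A L -> In l (suffixes L) -> In A l -> forall k,
  (k <= length L ->
   proved ([A; nm [TTh (remove_first A l) k]], [nm [TTh l (S k)]])) /\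
  (k <= length L + 1 ->
   proved ([nm [TTh l k]], [A; nm [TTh (remove_first A l) k]])).
Proof.
  intros hA hl hAl.
  induction l as [|B l IH]; [easy|].
  pose proof (suffixes_cons _ _ _ hl) as hl'.
  assert (hB : In B L) by (apply (suffixes_incl _ _ hl); simpl; auto).
  pose proof (base_fmls_atom E SQ _ hA) as hA'.
  pose proof (base_fmls_atom E SQ _ hB) as hB'.
  pose proof (single_tasks_fml E SQ _ hA') as hsA.
  pose proof (single_tasks_fml E SQ _ hB') as hsB.
  pose proof (z_base _ hA'). pose proof (z_base _ hB').
  pose proof (base_keyL _ hA'). pose proof (base_keyR _ hA').
  pose proof (bs_id E' A).
  pose proof (threshold_lists_suffix _ _ hl) as t1.
  pose proof (threshold_lists_suffix _ _ hl') as t2.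
  pose proof (threshold_lists_remove _ _ _ hA hl) as t3.
  pose proof (threshold_lists_remove _ _ _ hA hl') as t4.
  assert (hsingle : forall l k, In l (threshold_lists SQ) ->
    k <= length L + 1 -> In (TTh l k) (single_tasks E SQ))
    by (intros; now apply single_tasks_threshold).
  (* One unfolding of a threshold, together with the conjunction laws for its second disjunct. *)
  assert (hstep : forall C l k, In C L -> In (C :: l) (threshold_lists SQ) ->
    S k <= length L + 1 ->
    let X := FOr (nm [TTh l (S k)]) (nm [TF C; TTh l k]) in
    basic_sequent E' [nm [TTh (C :: l) (S k)]] [X] /\
    basic_sequent E' [X] [nm [TTh (C :: l) (S k)]] /\
    proved ([nm [TF C; TTh l k]], [nm [TF C]]) /\
    proved ([nm [TF C; TTh l k]], [nm [TTh l k]]) /\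
    proved ([nm [TF C]; nm [TTh l k]], [nm [TF C; TTh l k]])).
  { intros C l0 k hC hl0 hk X.
    pose proof (threshold_lists_cons _ _ _ hl0) as [_ hl1].
    assert (h1 : In (TTh (C :: l0) (S k)) (single_tasks E SQ)) by auto.
    assert (h2 : In (TTh l0 k) (single_tasks E SQ)) by (apply hsingle; auto; lia).
    pose proof (single_tasks_fml E SQ _ (base_fmls_atom E SQ _ hC)) as h3.
    stack_sequents [TTh (C :: l0) (S k)] (single_stack _ h1).
    pair_sequents (TF C) (TTh l0 k) h3 h2. auto. }
  cbn [remove_first] in *.
  destruct (fml_eq_dec A B) as [<-|hne].
  - intros k. split; intros hk.
    + destruct (hstep A l k) as (s1 & s2 & s3 & s4 & s5); [auto..|lia|].
      or_sequents E' (nm [TTh l (S k)]) (nm [TF A; TTh l k]).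
      apply generated_intro.
      { pose proof (key_up A (A :: l) k hA hl hk) as hkey. cbn in hkey.
        destruct (fml_eq_dec A A); [exact hkey|easy]. }
      cuts [nm [TF A]; nm [TF A; TTh l k];
        FOr (nm [TTh l (S k)]) (nm [TF A; TTh l k])].
    + apply generated_intro.
      { pose proof (key_down A (A :: l) k hA hl hk) as hkey. cbn in hkey.
        destruct (fml_eq_dec A A); [exact hkey|easy]. }
      destruct k as [|k].
      * destruct (threshold_zero _ t1) as (z1 & z2 & z3 & z4).
        destruct (threshold_zero _ t2) as (z5 & z6 & _ & _).
        cuts [nm []].
      * destruct (hstep A l k) as (s1 & s2 & s3 & s4 & s5); [auto..|].
        or_sequents E' (nm [TTh l (S k)]) (nm [TF A; TTh l k]).
        cuts [FOr (nm [TTh l (S k)]) (nm [TF A; TTh l k]);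
          nm [TTh l (S k)]; nm [TF A; TTh l k]; nm [TF A]].
  - destruct hAl as [hAl|hAl]; [congruence|].
    specialize (IH hl' hAl).
    intros k. split; intros hk.
    + apply generated_intro.
      { pose proof (key_up A (B :: l) k hA hl hk) as hkey. cbn in hkey.
        destruct (fml_eq_dec A B); [easy|exact hkey]. }
      destruct (hstep B l k) as (s1 & s2 & s3 & s4 & s5); [auto..|lia|].
      or_sequents E' (nm [TTh l (S k)]) (nm [TF B; TTh l k]).
      destruct (IH k) as [i1 _]. specialize (i1 hk).
      (* For [k = 0] the reduced threshold demands nothing and has no disjunction to unfold; [A]
         alone gives threshold 1 of the tail by the induction hypothesis. *)
      destruct k as [|k].
      * destruct (threshold_zero _ t4) as (z1 & z2 & z3 & z4).
        cuts [F1; nm []; nm [TTh (remove_first A l) 0]; nm [TTh l 1];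
          FOr (nm [TTh l 1]) (nm [TF B; TTh l 0])].
      * destruct (hstep B (remove_first A l) k) as (s6 & s7 & s8 & s9 & s10);
          [auto..|lia|].
        or_sequents E' (nm [TTh (remove_first A l) (S k)])
          (nm [TF B; TTh (remove_first A l) k]).
        (* In the disjunct with [B] true the tail is asked for one member fewer, hence the second
           use of the induction hypothesis, one step lower. *)
        destruct (IH k) as [i2 _]. specialize (i2 ltac:(lia)).
        cuts [FOr (nm [TTh (remove_first A l) (S k)])
                (nm [TF B; TTh (remove_first A l) k]);
          nm [TTh (remove_first A l) (S k)];
          nm [TF B; TTh (remove_first A l) k];
          nm [TF B]; nm [TTh (remove_first A l) k];
          nm [TTh l (S k)]; nm [TTh l (S (S k))]; nm [TF B; TTh l (S k)];
          FOr (nm [TTh l (S (S k))]) (nm [TF B; TTh l (S k)])].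
    + apply generated_intro.
      { pose proof (key_down A (B :: l) k hA hl hk) as hkey. cbn in hkey.
        destruct (fml_eq_dec A B); [easy|exact hkey]. }
      destruct k as [|k].
      * destruct (threshold_zero _ t3) as (z1 & z2 & z3 & z4).
        cuts [F1; nm []].
      * destruct (hstep B l k) as (s1 & s2 & s3 & s4 & s5); [auto..|].
        destruct (hstep B (remove_first A l) k) as (s6 & s7 & s8 & s9 & s10);
          [auto..|].
        or_sequents E' (nm [TTh l (S k)]) (nm [TF B; TTh l k]).
        or_sequents E' (nm [TTh (remove_first A l) (S k)])
          (nm [TF B; TTh (remove_first A l) k]).
        destruct (IH k) as [_ i1]. specialize (i1 ltac:(lia)).
        destruct (IH (S k)) as [_ i2]. specialize (i2 ltac:(lia)).
        cuts [FOr (nm [TTh l (S k)]) (nm [TF B; TTh l k]);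
          nm [TTh l (S k)]; nm [TF B; TTh l k]; nm [TF B]; nm [TTh l k];
          nm [TTh (remove_first A l) (S k)];
          nm [TTh (remove_first A l) k];
          nm [TF B; TTh (remove_first A l) k];
          FOr (nm [TTh (remove_first A l) (S k)])
                (nm [TF B; TTh (remove_first A l) k])].
Qed.

(** Both disjuncts of the unfolded threshold again ask for more members than the tail has, down to
    the empty list, where the definition is 0. *)
Lemma empty_key l :
  In l (suffixes L) -> forall k, length l < k -> k <= length L + 1 ->
  proved ([nm [TTh l k]], []).
Proof.
  induction l as [|B l IH]; intros hl k h1 h2.
  - apply generated_intro; [now constructor|].
    destruct k as [|k]; [easy|].
    assert (hs : In (TTh [] (S k)) (single_tasks E SQ)).
    { apply single_tasks_threshold; auto. now apply threshold_lists_suffix. }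
    stack_sequents [TTh [] (S k)] (single_stack _ hs). pose proof (bs_0 E').
    cuts [F0].
  - apply generated_intro; [now constructor|].
    destruct k as [|k]; [easy|]. simpl in h1.
    pose proof (suffixes_cons _ _ _ hl) as hl'.
    assert (hB : In B L) by (apply (suffixes_incl _ _ hl); simpl; auto).
    assert (hs : In (TTh (B :: l) (S k)) (single_tasks E SQ)).
    { apply single_tasks_threshold; auto. now apply threshold_lists_suffix. }
    assert (hs' : In (TTh l k) (single_tasks E SQ)).
    { apply single_tasks_threshold; [now apply threshold_lists_suffix|lia]. }
    pose proof (single_tasks_fml E SQ _ (base_fmls_atom E SQ _ hB)) as hsB.
    stack_sequents [TTh (B :: l) (S k)] (single_stack _ hs).
    pair_sequents (TF B) (TTh l k) hsB hs'.
    pose proof (IH hl' (S k) ltac:(lia) ltac:(lia)).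
    pose proof (IH hl' k ltac:(lia) ltac:(lia)).
    or_sequents E' (nm [TTh l (S k)]) (nm [TF B; TTh l k]).
    cuts [FOr (nm [TTh l (S k)]) (nm [TF B; TTh l k]);
      nm [TTh l (S k)]; nm [TF B; TTh l k]; nm [TTh l k]].
Qed.

(** * Values of queries and the sequents of the strategy *)

Lemma value_stack k Q b :
  k <= length L -> In Q SQ -> In [TQ k Q b] (all_stacks E SQ).
Proof. intros hk hQ. apply single_stack. now apply single_tasks_query. Qed.

(** For an atom [A] the two values are [A] and the threshold of the others, so both claims are
    [threshold_keys] for the whole list. The connectives are defined by De Morgan duality, which
    propagates both claims. *)
Lemma value_keys k Q :
  k <= length L -> In Q SQ ->
  proved ([threshold k], [value k Q true; value k Q false]) /\
  proved ([value k Q true; value k Q false], [threshold (S k)]).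
Proof.
  intros hk. induction Q as [A|Q IH|Q IHQ R IHR|Q IHQ R IHR]; intros hQ;
    [stack_sequents [TQ k (QF A) true] (value_stack k _ true hk hQ);
     stack_sequents [TQ k (QF A) false] (value_stack k _ false hk hQ)
    |stack_sequents [TQ k (QNeg Q) true] (value_stack k _ true hk hQ);
     stack_sequents [TQ k (QNeg Q) false] (value_stack k _ false hk hQ)
    |stack_sequents [TQ k (QOr Q R) true] (value_stack k _ true hk hQ);
     stack_sequents [TQ k (QOr Q R) false] (value_stack k _ false hk hQ)
    |stack_sequents [TQ k (QAnd Q R) true] (value_stack k _ true hk hQ);
     stack_sequents [TQ k (QAnd Q R) false] (value_stack k _ false hk hQ)].
  - pose proof (SQ_atom _ _ hQ) as hA.
    pose proof (base_fmls_atom E SQ _ hA) as hA'.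
    pose proof (z_base _ hA').
    pose proof (base_keyL _ hA'). pose proof (base_keyR _ hA').
    destruct (threshold_keys A L hA (suffixes_refl _) hA k) as [k1 k2].
    specialize (k1 hk). specialize (k2 ltac:(lia)).
    split; (apply generated_intro; [now constructor|]);
      cuts [nm [TTh (remove_first A L) k]; A; nm [TF A]].
  - destruct (IH (SQ_neg _ SQ_cl _ hQ)) as [k1 k2].
    split; (apply generated_intro; [now constructor|]);
      cuts [value k Q true; value k Q false].
  - pose proof (SQ_or _ SQ_cl _ _ hQ) as [hQ' hR'].
    destruct (IHQ hQ') as [k1 k2]. destruct (IHR hR') as [k3 k4].
    pair_sequents (TQ k Q false) (TQ k R false)
      (single_tasks_query E SQ k _ false hk hQ')
      (single_tasks_query E SQ k _ false hk hR').
    or_sequents E' (value k Q true) (value k R true).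
    split; (apply generated_intro; [now constructor|]);
      cuts [FOr (value k Q true) (value k R true);
        nm [TQ k Q false; TQ k R false];
        value k Q true; value k Q false; value k R true; value k R false].
  - pose proof (SQ_and _ SQ_cl _ _ hQ) as [hQ' hR'].
    destruct (IHQ hQ') as [k1 k2]. destruct (IHR hR') as [k3 k4].
    pair_sequents (TQ k Q true) (TQ k R true)
      (single_tasks_query E SQ k _ true hk hQ')
      (single_tasks_query E SQ k _ true hk hR').
    or_sequents E' (value k Q false) (value k R false).
    split; (apply generated_intro; [now constructor|]);
      cuts [FOr (value k Q false) (value k R false);
        nm [TQ k Q true; TQ k R true];
        value k Q true; value k Q false; value k R true; value k R false].
Qed.

Notation derivable := (cut_tree E' z proved).

(** Returns from the value of an atomic query to the formula, on the left if true and on the right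
    if false. If false, the branch where [A] holds has both values and closes by consistency with
    the upper threshold. Closing that branch takes up to two cuts, hence the depth [S (S n)] at
    least. *)
Lemma atom_intro k A b n G D :
  k <= length L -> In (QF A) SQ -> In (value k (QF A) b) G ->
  In (threshold (S k)) D ->
  derivable (S (S n)) (if b then A :: G else G) (if b then D else A :: D) ->
  derivable (S (S (S n))) G D.
Proof.
  intros hk hQ hG hD h.
  pose proof (SQ_atom _ _ hQ) as hA.
  pose proof (base_fmls_atom E SQ _ hA) as hA'.
  pose proof (z_base _ hA').
  pose proof (base_keyL _ hA'). pose proof (base_keyR _ hA').
  destruct (value_keys k _ hk hQ) as [_ k2].
  stack_sequents [TQ k (QF A) true] (value_stack k _ true hk hQ).
  destruct b.
  - apply ct_cut with A; auto. cuts [nm [TF A]].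
  - apply ct_cut with A; auto. cuts [nm [TF A]; value k (QF A) true].
Qed.

(** Contradictions among atoms become basic sequents, or a [simulates_key], once [atom_intro] has
    exposed the formulas. For compound queries the translation is unfolded and opposite values of
    the parts clash by consistency. *)
Lemma contradiction_derivable k C G D :
  k <= length L -> simple_contradiction E C ->
  (forall Q b, In (Q, b) C -> In Q SQ /\ In (value k Q b) G) ->
  In (threshold (S k)) D -> derivable 8 G D.
Proof.
  intros hk hC hG hD.
  assert (hb : forall A, In (QF A) SQ -> In A (base_fmls E SQ)).
  { intros A hA. now apply base_fmls_atom, SQ_atom. }
  destruct hC as [| |A0 A1 p b0 b1 i c hc|Q b|P Q0 Q1 i hor|P Q0 Q1 hor
    |Q0 Q1|Q0 Q1 i|i Ei b hi|A B hs].
  - destruct (hG (QF F0) true) as [hQ hV]; [simpl; auto|].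
    apply (atom_intro k F0 true); auto. pose proof (bs_0 E'). cuts (@nil fml).
  - destruct (hG (QF F1) false) as [hQ hV]; [simpl; auto|].
    apply (atom_intro k F1 false); auto. pose proof (bs_1 E'). cuts (@nil fml).
  - destruct (hG (QF A0) b0) as [h1 v1]; [simpl; auto|].
    destruct (hG (QF A1) b1) as [h2 v2]; [simpl; auto|].
    destruct (hG (QF (pvar p)) i) as [h3 v3]; [simpl; auto|].
    destruct (hG (QF (FDec A0 p A1)) c) as [h4 v4]; [simpl; auto|].
    dec_sequents E' A0 p A1.
    apply (atom_intro k A0 b0); auto.
    apply (atom_intro k A1 b1); auto; try (destruct b0; simpl; auto; fail).
    apply (atom_intro k (pvar p) i); auto;
      try (destruct b0, b1; simpl; auto; fail).
    apply (atom_intro k (FDec A0 p A1) c); auto;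
      try (destruct b0, b1, i; simpl; auto; fail).
    destruct b0, b1, i, c; try congruence; cuts (@nil fml).
  - destruct (hG Q b) as [h1 v1]; [simpl; auto|].
    destruct (hG (QNeg Q) b) as [h2 v2]; [simpl; auto|].
    destruct (value_keys k Q hk h1) as [_ k2].
    stack_sequents [TQ k (QNeg Q) b] (value_stack k _ b hk h2).
    destruct b; cbn [negb] in *; [cuts [value k Q false]|cuts [value k Q true]].
  - destruct hor as [A B|Q R].
    + destruct (hG (QF (FOr A B)) false) as [h1 v1]; [simpl; auto|].
      or_sequents E' A B.
      apply (atom_intro k (FOr A B) false); auto.
      destruct i.
      * destruct (hG (QF B) true) as [h2 v2]; [simpl; auto|].
        apply (atom_intro k B true); simpl; auto. cuts (@nil fml).
      * destruct (hG (QF A) true) as [h2 v2]; [simpl; auto|].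
        apply (atom_intro k A true); simpl; auto. cuts (@nil fml).
    + destruct (hG (QOr Q R) false) as [h1 v1]; [simpl; auto|].
      destruct (hG (if i then R else Q) true) as [h2 v2]; [simpl; auto|].
      pose proof (SQ_or _ SQ_cl _ _ h1) as [hQ hR].
      stack_sequents [TQ k (QOr Q R) false] (value_stack k _ false hk h1).
      pair_sequents (TQ k Q false) (TQ k R false)
        (single_tasks_query E SQ k _ false hk hQ)
        (single_tasks_query E SQ k _ false hk hR).
      destruct (value_keys k Q hk hQ) as [_ k1].
      destruct (value_keys k R hk hR) as [_ k2].
      destruct i; cuts [nm [TQ k Q false; TQ k R false];
        value k Q false; value k R false].
  - destruct hor as [A B|Q R].
    + destruct (hG (QF (FOr A B)) true) as [h1 v1]; [simpl; auto|].
      destruct (hG (QF A) false) as [h2 v2]; [simpl; auto|].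
      destruct (hG (QF B) false) as [h3 v3]; [simpl; auto|].
      or_sequents E' A B.
      apply (atom_intro k (FOr A B) true); auto.
      apply (atom_intro k A false); simpl; auto.
      apply (atom_intro k B false); simpl; auto. cuts (@nil fml).
    + destruct (hG (QOr Q R) true) as [h1 v1]; [simpl; auto|].
      destruct (hG Q false) as [hQ v2]; [simpl; auto|].
      destruct (hG R false) as [hR v3]; [simpl; auto|].
      stack_sequents [TQ k (QOr Q R) true] (value_stack k _ true hk h1).
      or_sequents E' (value k Q true) (value k R true).
      destruct (value_keys k Q hk hQ) as [_ k1].
      destruct (value_keys k R hk hR) as [_ k2].
      cuts [FOr (value k Q true) (value k R true); value k Q true;
        value k R true].
  - destruct (hG (QAnd Q0 Q1) false) as [h1 v1]; [simpl; auto|].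
    destruct (hG Q0 true) as [hQ v2]; [simpl; auto|].
    destruct (hG Q1 true) as [hR v3]; [simpl; auto|].
    stack_sequents [TQ k (QAnd Q0 Q1) false] (value_stack k _ false hk h1).
    or_sequents E' (value k Q0 false) (value k Q1 false).
    destruct (value_keys k Q0 hk hQ) as [_ k1].
    destruct (value_keys k Q1 hk hR) as [_ k2].
    cuts [FOr (value k Q0 false) (value k Q1 false); value k Q0 false;
      value k Q1 false].
  - destruct (hG (QAnd Q0 Q1) true) as [h1 v1]; [simpl; auto|].
    destruct (hG (if i then Q1 else Q0) false) as [h2 v2]; [simpl; auto|].
    pose proof (SQ_and _ SQ_cl _ _ h1) as [hQ hR].
    stack_sequents [TQ k (QAnd Q0 Q1) true] (value_stack k _ true hk h1).
    pair_sequents (TQ k Q0 true) (TQ k Q1 true)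
      (single_tasks_query E SQ k _ true hk hQ)
      (single_tasks_query E SQ k _ true hk hR).
    destruct (value_keys k Q0 hk hQ) as [_ k1].
    destruct (value_keys k Q1 hk hR) as [_ k2].
    destruct i; cuts [nm [TQ k Q0 true; TQ k Q1 true];
      value k Q0 true; value k Q1 true].
  - destruct (hG (QF (FExt i)) b) as [h1 v1]; [simpl; auto|].
    destruct (hG (QF Ei) (negb b)) as [h2 v2]; [simpl; auto|].
    pose proof (base_def i (hb _ h1)) as hd.
    rewrite (nth_error_nth _ _ F0 hi) in hd.
    pose proof (bs_unfold E' _ _ hd). pose proof (bs_fold E' _ _ hd).
    apply (atom_intro k (FExt i) b); auto.
    apply (atom_intro k Ei (negb b)); auto; try (destruct b; simpl; auto; fail).
    destruct b; cbn [negb]; cuts (@nil fml).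
  - destruct (hG (QF A) false) as [h1 v1]; [simpl; auto|].
    destruct (hG (QF B) true) as [h2 v2]; [simpl; auto|].
    pose proof (simulates_key A B hs (hb _ h1) (hb _ h2)).
    apply (atom_intro k A false); auto.
    apply (atom_intro k B true); simpl; auto. cuts (@nil fml).
Qed.

Lemma contradiction_length C : simple_contradiction E C -> length C <= 4.
Proof. destruct 1; simpl; lia. Qed.

(** Cuts in the values of the contradiction one by one. Each is already on the path or follows from
    [Gm] or [Dl] by at most two further cuts. *)
Lemma state_intro k P C : forall n G D,
  k <= length L ->
  (forall a, In a P -> In (fst a) SQ) ->
  incl C (P ++ initial_state Gm Dl) ->
  incl (fst (node_sequent k P)) G -> incl (snd (node_sequent k P)) D ->
  derivable (S (S n)) (map (fun a => value k (fst a) (snd a)) C ++ G) D ->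
  derivable (length C + S (S n)) G D.
Proof.
  induction C as [|[Q b] C IH]; intros n G D hk hP hC hG hD h; [exact h|].
  simpl length. rewrite Nat.add_succ_l.
  assert (hin : In (Q, b) (P ++ initial_state Gm Dl)) by (apply hC; simpl; auto).
  apply ct_cut with (value k Q b); [cbn [fml_size]; lia|..].
  - apply IH; auto.
    + intros x hx. apply hC; simpl; auto.
    + intros x hx. right. auto.
    + apply cut_tree_weakening with (2 := incl_refl _) (3 := h).
      intros x hx. simpl in hx. rewrite in_app_iff in *. simpl. tauto.
  - apply cut_tree_le with (S (S n)); [|lia].
    assert (hTh : In (threshold k) G) by (apply hG; simpl; auto).
    apply in_app_or in hin as [hin|hin].
    + pose proof (bs_id E' (value k Q b)).
      assert (In (value k Q b) G).
      { apply hG. simpl. right. apply in_or_app; left.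
        now apply (in_map (fun a => value k (fst a) (snd a)) P (Q, b)). }
      cuts (@nil fml).
    + unfold initial_state in hin.
      apply in_app_or in hin as [hin|hin];
        apply in_map_iff in hin as (A & e & hA); injection e as <- <-.
      * pose proof (Gm_SQ _ hA) as hQ.
        pose proof (base_keyR _ (base_fmls_atom E SQ _ (SQ_atom _ _ hQ))).
        stack_sequents [TQ k (QF A) true] (value_stack k _ true hk hQ).
        assert (In A G) by (apply hG; simpl; right; apply in_or_app; auto).
        cuts [nm [TF A]].
      (* A formula on the right supplies no value directly. In the slice one of the two values holds
         by completeness, and the value true would give [A], which is on the right. *)
      * pose proof (Dl_SQ _ hA) as hQ.
        pose proof (base_keyL _ (base_fmls_atom E SQ _ (SQ_atom _ _ hQ))).
        stack_sequents [TQ k (QF A) true] (value_stack k _ true hk hQ).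
        destruct (value_keys k _ hk hQ) as [k1 _].
        assert (In A D) by (apply hD; simpl; auto).
        cuts [value k (QF A) true; nm [TF A]].
Qed.

(** At an inner node, completeness says that one of the two values of the query holds, so the
    sequents of the children combine by two cuts. The path inclusion keeps every state met among the
    keys of the whole tree. *)
Lemma node_keys k U : forall P,
  k <= length L ->
  (forall a, In a P -> In (fst a) SQ) ->
  (forall Q, In Q (tree_queries U) -> In Q SQ) ->
  incl (tree_paths P U) (tree_paths [] T) ->
  winning E (P ++ initial_state Gm Dl) U ->
  proved (node_sequent k P).
Proof.
  induction U as [|Q U0 IH0 U1 IH1]; intros P hk hP hU hpaths hwin.
  - destruct hwin as (C & hC & hincl).
    apply generated_intro.
    { apply key_node; auto. apply hpaths; simpl; auto. }
    apply cut_tree_le with (length C + 8);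
      [|pose proof (contradiction_length _ hC); lia].
    apply (state_intro k P); auto using incl_refl.
    apply contradiction_derivable with (k := k) (C := C); auto; [|simpl; auto].
    intros Q b hQ. split.
    + apply hincl, in_app_or in hQ as [h|h]; [now apply (hP _ h)|].
      unfold initial_state in h.
      apply in_app_or in h as [h|h];
        apply in_map_iff in h as (A & e & hA); injection e as <- <-; auto.
    + apply in_or_app; left.
      now apply (in_map (fun a => value k (fst a) (snd a)) C (Q, b)).
  - destruct hwin as [w0 w1].
    assert (hQ : In Q SQ) by (apply hU; simpl; auto).
    assert (k0 : proved (node_sequent k ((Q, false) :: P))).
    { apply IH0; auto.
      - intros a [<-|ha]; auto.
      - intros R hR. apply hU. simpl. right. apply in_or_app; auto.
      - intros x hx. apply hpaths. simpl. right. apply in_or_app; auto. }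
    assert (k1 : proved (node_sequent k ((Q, true) :: P))).
    { apply IH1; auto.
      - intros a [<-|ha]; auto.
      - intros R hR. apply hU. simpl. right. apply in_or_app; auto.
      - intros x hx. apply hpaths. simpl. right. apply in_or_app; auto. }
    destruct (value_keys k Q hk hQ) as [k2 _].
    apply generated_intro.
    { apply key_node; auto. apply hpaths; simpl; auto. }
    assert (hinc : forall b, incl (fst (node_sequent k ((Q, b) :: P)))
      (value k Q b :: fst (node_sequent k P))).
    { intros b x. simpl. tauto. }
    apply ct_cut with (value k Q true); [cbn [fml_size]; lia|..].
    + eapply ct_key; [exact k1|apply hinc|apply incl_refl].
    + apply ct_cut with (value k Q false); [cbn [fml_size]; lia|..].
      * eapply ct_key; [exact k0|apply hinc|].
        apply incl_tl, incl_refl.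
      * leaf.
Qed.

Lemma chain_key : NB_proof E Gm Dl T -> forall k, k <= length L + 1 ->
  proved (Gm, threshold k :: Dl).
Proof.
  intros hT. induction k as [|k IH]; intros hk;
    (apply generated_intro; [now constructor|]).
  - destruct (threshold_zero L) as (z1 & z2 & z3 & z4).
    { apply threshold_lists_suffix, suffixes_refl. }
    cuts [F1; nm []].
  - specialize (IH ltac:(lia)).
    assert (hn : proved (node_sequent k [])).
    { apply (node_keys k T); auto; try lia; easy. }
    apply ct_cut with (threshold k); [cbn [fml_size]; lia|..].
    + eapply ct_key; [exact hn|apply incl_refl|apply incl_refl].
    + eapply ct_key; [exact IH|apply incl_refl|].
      intros x [<-|hx]; simpl; auto.
Qed.

Lemma goal_key : NB_proof E Gm Dl T -> proved (Gm, Dl).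
Proof.
  intros hT. apply generated_intro; [now constructor|].
  pose proof (chain_key hT (length L + 1) ltac:(lia)) as h1.
  pose proof (empty_key L (suffixes_refl _) (length L + 1) ltac:(lia) ltac:(lia)).
  apply ct_cut with (threshold (length L + 1)); [cbn [fml_size]; lia|leaf|].
  eapply ct_key; [exact h1|apply incl_refl|apply incl_refl].
Qed.

End Keys.

(** * The extended set of axioms *)

Fixpoint insert_by {X} (r : X -> nat) (x : X) (l : list X) : list X :=
  match l with
  | [] => [x]
  | y :: l' => if r x <=? r y then x :: l else y :: insert_by r x l'
  end.

Lemma insert_by_spec {X} (r : X -> nat) x l :
  StronglySorted (fun a b => r a <= r b) l ->
  StronglySorted (fun a b => r a <= r b) (insert_by r x l) /\
  (forall y, In y (insert_by r x l) <-> y = x \/ In y l).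
Proof.
  induction l as [|y l IH]; intros h; simpl.
  - split; [repeat constructor|]. intros y. intuition.
  - inversion h as [|? ? hs hf]; subst. destruct (IH hs) as [h1 h2].
    destruct (Nat.leb_spec (r x) (r y)) as [hxy|hxy].
    + split; [|intros u; simpl; intuition].
      constructor; auto. constructor; auto.
      eapply Forall_impl; [|exact hf]. simpl; intros; lia.
    + split.
      * constructor; auto. apply Forall_forall. intros u hu.
        apply h2 in hu as [->|hu]; [lia|].
        rewrite Forall_forall in hf; auto.
      * intros u. simpl. rewrite h2. intuition.
Qed.

(** Applied with the rank of stacks, it lists every name after the names in its definition, as
    stratified axioms demand. *)
Lemma sorted_by_exists {X} (r : X -> nat) (l : list X) :
  exists l', StronglySorted (fun a b => r a <= r b) l' /\
    (forall y, In y l' <-> In y l).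
Proof.
  induction l as [|x l (l' & h1 & h2)].
  - exists []. split; [constructor|easy].
  - destruct (insert_by_spec r x l' h1) as [h3 h4].
    exists (insert_by r x l'). split; auto.
    intros y. rewrite h4, h2. simpl. intuition.
Qed.

Fixpoint position (s : stack) (l : list stack) : nat :=
  match l with
  | [] => 0
  | t :: l => if stack_eq_dec s t then 0 else S (position s l)
  end.

Lemma position_nth s l : In s l -> nth_error l (position s l) = Some s.
Proof.
  induction l as [|t l IH]; simpl; [easy|]. intros h.
  destruct (stack_eq_dec s t) as [->|hne]; [reflexivity|].
  simpl. apply IH. destruct h; [congruence|auto].
Qed.

(** A name may occur repeatedly in the list and then receives an axiom at each occurrence, while its
    index is that of the first one. A later copy lies still further above the children. *)
Lemma position_le s l j : nth_error l j = Some s -> position s l <= j.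
Proof.
  revert j. induction l as [|t l IH]; intros [|j]; simpl; try easy.
  - intros [= ->]. destruct (stack_eq_dec s s); [lia|easy].
  - intros h. destruct (stack_eq_dec s t); [lia|]. specialize (IH _ h). lia.
Qed.

Lemma position_sorted (r : stack -> nat) l t s :
  StronglySorted (fun a b => r a <= r b) l ->
  In t l -> In s l -> r t < r s -> position t l < position s l.
Proof.
  induction l as [|x l IH]; simpl; [easy|]. intros h ht hs hr.
  inversion h as [|? ? hs' hf]; subst.
  destruct (stack_eq_dec t x) as [->|ht'], (stack_eq_dec s x) as [->|hs''];
    try lia.
  - destruct ht as [ht|ht]; [congruence|].
    rewrite Forall_forall in hf. specialize (hf _ ht). lia.
  - destruct ht as [ht|ht]; [congruence|]. destruct hs as [hs|hs]; [congruence|].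
    specialize (IH hs' ht hs hr). lia.
Qed.

Lemma shape_fml_below idx h n :
  (forall u, In u (shape_children h) -> idx u < n) ->
  ext_vars_below n (shape_fml idx h).
Proof. destruct h; simpl; auto. Qed.

Lemma ext_vars_bound (l : list fml) : exists n, forall i, In (FExt i) l -> i < n.
Proof.
  induction l as [|A l [n hn]]; [exists 0; easy|].
  exists (S n + match A with FExt i => i | _ => 0 end).
  intros i [->|h]; [lia|]. specialize (hn _ h). lia.
Qed.

Lemma extended_axioms E SQ W :
  2 <= W -> (forall A, In A E -> fml_size A < W) -> ext_axioms E ->
  (forall Q R, In Q SQ -> In R (subqueries Q) -> In R SQ) ->
  exists E' idx, ext_axioms E' /\ axioms_incl E E' /\
    (forall s, In s (all_stacks E SQ) ->
       in_axioms E' (idx s) (shape_fml idx (stack_def E SQ s))) /\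
    (forall i, In (FExt i) (base_fmls E SQ) -> in_axioms E' i (nth i E F0)).
Proof.
  intros hW1 hW2 hE hSQ.
  destruct (sorted_by_exists (stack_rank SQ W) (all_stacks E SQ))
    as (names & hsort & hnames).
  destruct (ext_vars_bound (base_fmls E SQ)) as [n hn].
  (* Extension variables without an axiom in [E] may occur in the formulas and must not be captured
     by new names. Padding gives them the axiom 0, matching the default in [nth i E F0], and moves
     the new indices beyond them. *)
  set (E1 := E ++ repeat F0 n).
  set (idx := fun s => length E1 + position s names).
  set (d := fun s => shape_fml idx (stack_def E SQ s)).
  exists (E1 ++ map d names), idx.
  assert (hlen : length E1 = length E + n).
  { unfold E1. now rewrite length_app, repeat_length. }
  assert (hinclE : axioms_incl E (E1 ++ map d names)).
  { intros i A h. unfold in_axioms, E1 in *. rewrite <- app_assoc.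
    rewrite nth_error_app1; auto. apply nth_error_Some. congruence. }
  assert (hchild : forall s u, In s names ->
    In u (shape_children (stack_def E SQ s)) -> position u names < position s names).
  { intros s u hs hu. apply position_sorted with (stack_rank SQ W); auto.
    - apply hnames. apply hnames in hs. eapply all_stacks_closed; eauto.
    - eapply stack_def_rank; eauto. }
  repeat split; auto.
  - intros i A h. unfold in_axioms in h.
    destruct (Nat.lt_ge_cases i (length E1)) as [hi|hi].
    + rewrite nth_error_app1 in h by auto. unfold E1 in h.
      destruct (Nat.lt_ge_cases i (length E)) as [hi'|hi'].
      * rewrite nth_error_app1 in h by auto. now apply hE.
      * rewrite nth_error_app2 in h by auto.
        apply nth_error_In, repeat_spec in h. subst A. exact I.
    + rewrite nth_error_app2 in h by auto. rewrite nth_error_map in h.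
      destruct (nth_error names (i - length E1)) as [s|] eqn:e; [|easy].
      injection h as <-. apply shape_fml_below. intros u hu.
      pose proof (hchild s u (nth_error_In _ _ e) hu).
      pose proof (position_le _ _ _ e). unfold idx. lia.
  - intros s hs. apply hnames in hs. unfold in_axioms, idx.
    rewrite nth_error_app2 by lia.
    replace (length E1 + position s names - length E1) with (position s names)
      by lia.
    rewrite nth_error_map, position_nth by auto. reflexivity.
  - intros i hi.
    destruct (Nat.lt_ge_cases i (length E)) as [hi'|hi'].
    + apply hinclE. now apply nth_error_nth'.
    + rewrite nth_overflow by auto. unfold in_axioms.
      specialize (hn _ hi). rewrite nth_error_app1 by lia. unfold E1.
      rewrite nth_error_app2 by auto. apply nth_error_repeat. lia.
Qed.

(** * Counting *)

Lemma length_flat_map_le {X Y} (f : X -> list Y) l c :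
  (forall x, In x l -> length (f x) <= c) ->
  length (flat_map f l) <= length l * c.
Proof.
  induction l as [|x l IH]; intros h; simpl; [lia|].
  rewrite length_app. pose proof (h x (or_introl eq_refl)).
  specialize (IH (fun y hy => h y (or_intror hy))). lia.
Qed.

Lemma length_flat_map_const {X Y} (f : X -> list Y) l c :
  (forall x, length (f x) = c) -> length (flat_map f l) = length l * c.
Proof.
  intros h. induction l as [|x l IH]; simpl; [lia|].
  now rewrite length_app, h, IH.
Qed.

Lemma length_suffixes l : length (suffixes l) = length l + 1.
Proof. induction l; simpl; lia. Qed.

Lemma length_subfmls A : length (subfmls A) = fml_size A.
Proof. induction A; simpl; rewrite ?length_app; lia. Qed.

Lemma subfmls_size A B : In B (subfmls A) -> fml_size B <= fml_size A.
Proof.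
  induction A; simpl; intros [<-|h]; simpl; try lia; try easy;
    apply in_app_or in h as [h|h];
    try specialize (IHA1 h); try specialize (IHA2 h); lia.
Qed.

Lemma length_subqueries Q : length (subqueries Q) <= query_size Q.
Proof.
  induction Q as [A|Q IH|Q IHQ R IHR|Q IHQ R IHR]; simpl; rewrite ?length_app;
    try lia.
  destruct A; simpl; lia.
Qed.

Lemma subqueries_size Q R : In R (subqueries Q) -> query_size R <= query_size Q.
Proof.
  induction Q; simpl; intros [<-|h]; simpl; try lia; try easy;
    try (specialize (IHQ h); lia);
    apply in_app_or in h as [h|h];
    try specialize (IHQ1 h); try specialize (IHQ2 h); lia.
Qed.

Lemma subqueries_atoms_size Q :
  fmls_size (flat_map query_atom (subqueries Q)) <= query_size Q.
Proof.
  induction Q; simpl; rewrite ?flat_map_app, ?fmls_size_app; try lia.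
  unfold fmls_size; simpl; lia.
Qed.

Definition queries_size (l : list query) : nat := list_sum (map query_size l).

Lemma queries_size_app l l' :
  queries_size (l ++ l') = queries_size l + queries_size l'.
Proof. unfold queries_size. now rewrite map_app, list_sum_app. Qed.

Lemma query_size_le_in Q l : In Q l -> query_size Q <= queries_size l.
Proof.
  unfold queries_size, list_sum. induction l as [|R l IH]; simpl; [easy|].
  intros [->|h]; [lia|]. specialize (IH h). lia.
Qed.

Definition all_subqueries (l : list query) : list query :=
  flat_map subqueries l.

Lemma all_subqueries_closed l Q R :
  In Q (all_subqueries l) -> In R (subqueries Q) -> In R (all_subqueries l).
Proof.
  intros h hR. apply in_flat_map in h as (P & h1 & h2).
  apply in_flat_map. exists P. split; auto. eapply subqueries_trans; eauto.
Qed.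

Lemma length_all_subqueries l : length (all_subqueries l) <= queries_size l.
Proof.
  unfold all_subqueries, queries_size, list_sum.
  induction l as [|Q l IH]; simpl; [lia|]. rewrite length_app.
  pose proof (length_subqueries Q). lia.
Qed.

Lemma all_subqueries_atoms_size l :
  fmls_size (atoms (all_subqueries l)) <= queries_size l.
Proof.
  unfold atoms, all_subqueries, queries_size, list_sum.
  induction l as [|Q l IH]; simpl; [unfold fmls_size; simpl; lia|].
  rewrite flat_map_app, fmls_size_app.
  pose proof (subqueries_atoms_size Q). lia.
Qed.

Lemma length_atoms SQ : length (atoms SQ) <= length SQ.
Proof.
  unfold atoms. rewrite <- (Nat.mul_1_r (length SQ)).
  apply length_flat_map_le. intros [] _; simpl; lia.
Qed.

Lemma length_flat_subfmls l : length (flat_map subfmls l) = fmls_size l.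
Proof.
  induction l as [|A l IH]; [reflexivity|].
  simpl. now rewrite length_app, length_subfmls, IH, fmls_size_cons.
Qed.

Lemma tree_queries_size T : queries_size (tree_queries T) <= strategy_size T.
Proof.
  induction T as [|Q T0 IH0 T1 IH1]; simpl; [unfold queries_size; simpl; lia|].
  change (queries_size (Q :: ?l)) with (query_size Q + queries_size l).
  rewrite queries_size_app. lia.
Qed.

Lemma length_tree_paths T : forall P, length (tree_paths P T) <= strategy_size T.
Proof.
  induction T as [|Q T0 IH0 T1 IH1]; intros P; simpl; [lia|].
  rewrite length_app.
  specialize (IH0 ((Q, false) :: P)). specialize (IH1 ((Q, true) :: P)). lia.
Qed.

Lemma tree_paths_length T : forall P S,
  In S (tree_paths P T) -> length S <= length P + strategy_size T.
Proof.
  induction T as [|Q T0 IH0 T1 IH1]; intros P S [<-|h]; simpl; try lia.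
  - easy.
  - apply in_app_or in h as [h|h]; [apply IH0 in h|apply IH1 in h];
      simpl in h; lia.
Qed.

Ltac monotone :=
  repeat lazymatch goal with
    | |- _ + _ <= _ + _ => apply Nat.add_le_mono
    | |- _ * _ <= _ * _ => apply Nat.mul_le_mono
    end; try assumption; try lia.

(** There are [n + 1] suffixes and [n * (n + 1)] suffixes with an atom removed, together the square
    of [n + 1]; the last factor counts the thresholds of one list. *)
Definition thresholds_bound (n : nat) : nat := (n + 1) * (n + 1) * (n + 2).
Definition single_tasks_bound (n : nat) : nat :=
  (n + 1) + (thresholds_bound n + (n + 1) * (n * 2)).
Definition threshold_stacks_bound (n : nat) : nat :=
  1 + ((n + 1) + (thresholds_bound n + (n + 1) * thresholds_bound n)).
Definition prefix_stacks_bound (n : nat) : nat :=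
  threshold_stacks_bound n +
  (n + 1) * (n * (2 * (n * (1 + threshold_stacks_bound n)))).
(** The summands follow the constructors of [key] in order, with a factor 2 or 3 where constructors
    over the same parameters are counted together. *)
Definition keys_bound (n : nat) : nat :=
  (n + 1) * (n + 1) + (prefix_stacks_bound n * single_tasks_bound n * 3 +
  ((n + 1) * 2 + (n * (n + 1) * (n + 2) * 2 + ((n + 1) * (n + 2) +
  ((n + 1) * n * 2 + ((n + 1) * n + (n + 2 + 1))))))).

Section Counting.
Variables (E : axiom_list) (SQ : list query) (n : nat).
Hypothesis SQ_length : length SQ <= n.
Hypothesis SQ_size : forall Q, In Q SQ -> query_size Q <= n.
Hypothesis base_length : length (base_fmls E SQ) <= n + 1.

Lemma atoms_le : length (atoms SQ) <= n.
Proof. pose proof (length_atoms SQ). lia. Qed.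

Lemma length_thresholds : length (thresholds SQ) <= thresholds_bound n.
Proof.
  pose proof atoms_le as ha. unfold thresholds, thresholds_bound.
  etransitivity; [apply length_flat_map_le with (c := n + 2)|].
  - intros l _. rewrite length_map, length_seq. lia.
  - apply Nat.mul_le_mono; [|lia]. unfold threshold_lists.
    rewrite length_app, length_suffixes.
    pose proof (length_flat_map_le
      (fun A => map (remove_first A) (suffixes (atoms SQ))) (atoms SQ) (n + 1)) as h.
    etransitivity; [apply Nat.add_le_mono_l, h|nia].
    intros A _. rewrite length_map, length_suffixes. lia.
Qed.

Lemma length_single_tasks : length (single_tasks E SQ) <= single_tasks_bound n.
Proof.
  pose proof atoms_le as ha. pose proof length_thresholds.
  unfold single_tasks, single_tasks_bound.
  rewrite !length_app, length_map. apply Nat.add_le_mono; [lia|].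
  apply Nat.add_le_mono; [lia|].
  etransitivity; [apply length_flat_map_le with (c := n * 2)|].
  - intros k _. etransitivity; [apply length_flat_map_le with (c := 2)|lia].
    simpl; lia.
  - unfold slices. rewrite length_seq. monotone.
Qed.

Lemma length_threshold_stacks :
  length (threshold_stacks E SQ) <= threshold_stacks_bound n.
Proof.
  pose proof length_thresholds.
  unfold threshold_stacks, threshold_stacks_bound. cbn [length].
  rewrite !length_app, !length_map. apply le_n_S.
  apply Nat.add_le_mono; [lia|]. apply Nat.add_le_mono; [lia|].
  etransitivity; [apply length_flat_map_le with (c := thresholds_bound n)|].
  - intros A _. now rewrite length_map.
  - monotone.
Qed.

Lemma length_query_stacks k Q : forall b,
  length (query_stacks E SQ k Q b) <=
  query_size Q * (1 + threshold_stacks_bound n).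
Proof.
  pose proof length_threshold_stacks.
  induction Q as [A|Q IH|Q IHQ R IHR|Q IHQ R IHR]; intros b;
    cbn [query_stacks length query_size]; rewrite ?length_app, ?length_map;
    set (x := threshold_stacks_bound n) in *; clearbody x.
  - assert (1 <= fml_size A) by (destruct A; simpl; lia). nia.
  - specialize (IH (negb b)). nia.
  - etransitivity; [apply le_n_S, Nat.add_le_mono; [apply IHQ|apply IHR]|nia].
  - etransitivity; [apply le_n_S, Nat.add_le_mono; [apply IHQ|apply IHR]|nia].
Qed.

Lemma length_prefix_stacks : length (prefix_stacks E SQ) <= prefix_stacks_bound n.
Proof.
  pose proof atoms_le as ha. pose proof length_threshold_stacks.
  unfold prefix_stacks, prefix_stacks_bound. rewrite length_app.
  apply Nat.add_le_mono; [assumption|].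
  etransitivity;
    [apply length_flat_map_le
       with (c := n * (2 * (n * (1 + threshold_stacks_bound n))))|].
  - intros k _. etransitivity;
      [apply length_flat_map_le
         with (c := 2 * (n * (1 + threshold_stacks_bound n)))|].
    + intros Q hQ. rewrite length_app.
      pose proof (length_query_stacks k Q true) as h1.
      pose proof (length_query_stacks k Q false) as h2.
      pose proof (Nat.mul_le_mono_r _ _ (1 + threshold_stacks_bound n)
        (SQ_size _ hQ)). lia.
    + monotone.
  - unfold slices. rewrite length_seq. monotone.
Qed.

Lemma keys_enumerated Gm Dl T idx :
  strategy_size T <= n ->
  exists U, (forall s, key E SQ Gm Dl T idx s -> In s U) /\
    length U <= keys_bound n.
Proof.
  intros hT.
  pose proof atoms_le as ha. pose proof length_prefix_stacks as hp.
  pose proof length_single_tasks as hst.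
  pose proof (length_tree_paths T []) as ht.
  set (nm := fun s => FExt (idx s)).
  set (L := atoms SQ).
  exists (
    map (fun x => ([snd x], [fst x]))
      (list_prod (base_fmls E SQ) (base_fmls E SQ)) ++
    flat_map (fun x =>
      let t := fst x in let a := snd x in
      [([nm (t ++ [a])], [nm t]); ([nm (t ++ [a])], [nm [a]]);
       ([nm t; nm [a]], [nm (t ++ [a])])])
      (list_prod (prefix_stacks E SQ) (single_tasks E SQ)) ++
    flat_map (fun A => [([nm [TF A]], [A]); ([A], [nm [TF A]])]) (base_fmls E SQ) ++
    flat_map (fun x =>
      let A := fst (fst x) in let l := snd (fst x) in let k := snd x in
      [([A; nm [TTh (remove_first A l) k]], [nm [TTh l (S k)]]);
       ([nm [TTh l k]], [A; nm [TTh (remove_first A l) k]])])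
      (list_prod (list_prod L (suffixes L)) (seq 0 (length L + 2))) ++
    map (fun x => ([nm [TTh (fst x) (snd x)]], []))
      (list_prod (suffixes L) (seq 0 (length L + 2))) ++
    flat_map (fun x =>
      let k := fst x in let Q := snd x in
      [([nm [TTh L k]], [nm [TQ k Q true]; nm [TQ k Q false]]);
       ([nm [TQ k Q true]; nm [TQ k Q false]], [nm [TTh L (S k)]])])
      (list_prod (seq 0 (length L + 1)) SQ) ++
    map (fun x => node_sequent SQ Gm Dl idx (fst x) (snd x))
      (list_prod (seq 0 (length L + 1)) (tree_paths [] T)) ++
    map (fun k => (Gm, nm [TTh L k] :: Dl)) (seq 0 (length L + 2)) ++ [(Gm, Dl)]).
  split.
  - assert (hk1 : forall k, k <= length L -> In k (seq 0 (length L + 1)))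
      by (intros; apply in_seq; lia).
    assert (hk2 : forall k, k <= length L + 1 -> In k (seq 0 (length L + 2)))
      by (intros; apply in_seq; lia).
    intros s hs. rewrite !in_app_iff, !in_map_iff, !in_flat_map.
    destruct hs as [A B hA hB|t a ht' ha'|t a ht' ha'|t a ht' ha'|A hA|A hA
      |A l k hA hl hk|A l k hA hl hk|l k hl hk|k Q hk hQ|k Q hk hQ|k S hk hS
      |k hk|].
    + left. exists (A, B). split; [reflexivity|]. now apply in_prod.
    + right; left. exists (t, a). split; [now apply in_prod|]. simpl; auto.
    + right; left. exists (t, a). split; [now apply in_prod|]. simpl; auto.
    + right; left. exists (t, a). split; [now apply in_prod|]. simpl; auto.
    + do 2 right; left. exists A. simpl; auto.
    + do 2 right; left. exists A. simpl; auto.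
    + do 3 right; left. exists ((A, l), k).
      split; [repeat apply in_prod; auto with arith|]. simpl; auto.
    + do 3 right; left. exists ((A, l), k).
      split; [repeat apply in_prod; auto|]. simpl; auto.
    + do 4 right; left. exists (l, k). split; [reflexivity|].
      apply in_prod; auto.
    + do 5 right; left. exists (k, Q). split; [apply in_prod; auto|].
      simpl; auto.
    + do 5 right; left. exists (k, Q). split; [apply in_prod; auto|].
      simpl; auto.
    + do 6 right; left. exists (k, S). split; [reflexivity|].
      apply in_prod; auto.
    + do 7 right; left. exists k. auto.
    + do 8 right. simpl; auto.
  - assert (hL : length L <= n) by exact ha.
    rewrite !length_app, !length_map. unfold keys_bound.
    rewrite (length_flat_map_const _ _ 3) by reflexivity.
    rewrite !(length_flat_map_const _ _ 2) by reflexivity.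
    cbn [length]; rewrite ?length_prod, ?length_seq, ?length_suffixes.
    monotone.
Qed.

End Counting.

(** * Polynomial bounds and conclusion *)

Definition polynomially_bounded (f : nat -> nat) : Prop :=
  exists c d, forall n, 1 <= n -> f n <= c * n ^ d.

Lemma polynomially_bounded_const c : polynomially_bounded (fun _ => c).
Proof. exists c, 0. intros. simpl. lia. Qed.

Lemma polynomially_bounded_id : polynomially_bounded (fun n => n).
Proof. exists 1, 1. intros. simpl. lia. Qed.

Lemma polynomially_bounded_add f g :
  polynomially_bounded f -> polynomially_bounded g ->
  polynomially_bounded (fun n => f n + g n).
Proof.
  intros (c & d & hf) (c' & d' & hg). exists (c + c'), (d + d').
  intros n hn. specialize (hf n hn). specialize (hg n hn).
  rewrite Nat.pow_add_r.
  pose proof (Nat.pow_nonzero n d). pose proof (Nat.pow_nonzero n d').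
  set (x := n ^ d) in *. set (y := n ^ d') in *.
  assert (x <= x * y) by nia. assert (y <= x * y) by nia.
  nia.
Qed.

Lemma polynomially_bounded_mul f g :
  polynomially_bounded f -> polynomially_bounded g ->
  polynomially_bounded (fun n => f n * g n).
Proof.
  intros (c & d & hf) (c' & d' & hg). exists (c * c'), (d + d').
  intros n hn. specialize (hf n hn). specialize (hg n hn).
  rewrite Nat.pow_add_r.
  replace (c * c' * (n ^ d * n ^ d')) with ((c * n ^ d) * (c' * n ^ d')) by ring.
  now apply Nat.mul_le_mono.
Qed.

(** For fixed depth [m] the cost is an affine function of the weakening cost; [m] enters
    exponentially, but only into the constants. *)
Lemma polynomially_bounded_cut_tree_cost m f :
  polynomially_bounded f -> polynomially_bounded (fun n => cut_tree_cost m (f n)).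
Proof.
  intros hf. induction m as [|m IH]; cbn [cut_tree_cost];
    auto using polynomially_bounded_add, polynomially_bounded_mul,
      polynomially_bounded_const.
Qed.

(** The first factor is the line size [24 * b + 1], where [b] allows [3 * n + 20] symbols for a side
    of a key and 16 cut formulas of size at most [n + 3]. The width [2 * n + 20] covers a path, a
    context, a threshold and 16 cut formulas. The rest is the cost of one cut tree times the number
    of keys. *)
Definition proof_size_bound (n : nat) : nat :=
  (24 * (3 * n + 20 + 16 * (n + 3)) + 1) *
  (cut_tree_cost 16 (weakening_cost (2 * n + 20)) * keys_bound n).

Lemma proof_size_bound_polynomial : polynomially_bounded proof_size_bound.
Proof.
  unfold proof_size_bound, keys_bound, prefix_stacks_bound, single_tasks_bound,
    threshold_stacks_bound, thresholds_bound, weakening_cost.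
  repeat lazymatch goal with
  | |- polynomially_bounded (fun n => cut_tree_cost _ (@?f n)) =>
      apply (polynomially_bounded_cut_tree_cost _ f)
  | |- polynomially_bounded (fun n => @?f n + @?g n) =>
      apply (polynomially_bounded_add f g)
  | |- polynomially_bounded (fun n => @?f n * @?g n) =>
      apply (polynomially_bounded_mul f g)
  | |- polynomially_bounded (fun n => n) => apply polynomially_bounded_id
  | |- polynomially_bounded (fun _ => ?c) =>
      apply (polynomially_bounded_const c)
  end.
Qed.

Theorem theorem6p1 :
  exists c d : nat,
  forall (E : axiom_list) (Gamma Delta : list fml) (T : strategy),
    ext_axioms E ->
    NB_proof E Gamma Delta T ->
    exists (E' : axiom_list) (pi : list sequent),
      ext_axioms E' /\ axioms_incl E E' /\
      eLNDT_proof E' pi (Gamma, Delta) /\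
      eLNDT_size pi <= c * NB_size E Gamma Delta T ^ d.
Proof.
  destruct proof_size_bound_polynomial as (c & d & hbound).
  exists c, d. intros E Gm Dl T hE hT.
  set (N := NB_size E Gm Dl T).
  (* The formulas of the sequent count as queries: the initial state assigns values to them, so they
     too must be among the atoms of the slices. *)
  set (roots := map QF (Gm ++ Dl) ++ tree_queries T).
  set (SQ := all_subqueries roots).
  assert (hqs : queries_size (map QF (Gm ++ Dl)) = fmls_size (Gm ++ Dl)).
  { unfold queries_size, fmls_size. now rewrite map_map. }
  assert (hinit : fmls_size (Gm ++ Dl) + length (Gm ++ Dl) <=
    state_size (initial_state Gm Dl)).
  { unfold state_size, initial_state. rewrite map_app, !map_map, fmls_size_app.
    rewrite list_sum_app, length_app.
    assert (h : forall l, fmls_size l + length l <=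
      list_sum (map (fun x => fml_size x + 2) l)).
    { induction l as [|A l IH]; unfold fmls_size, list_sum in *; simpl; lia. }
    pose proof (h Gm). pose proof (h Dl). cbn [fst query_size]. lia. }
  assert (haxs : fmls_size E <= axioms_size E).
  { clear. unfold axioms_size, fmls_size, list_sum.
    induction E as [|A l IH]; simpl in *; lia. }
  assert (hroots : fmls_size E + queries_size roots <= N).
  { unfold roots, N, NB_size. rewrite queries_size_app.
    pose proof (tree_queries_size T). lia. }
  assert (hctx : fmls_size Gm + fmls_size Dl + length Gm + length Dl <= N).
  { rewrite fmls_size_app, length_app in hinit. unfold N, NB_size. lia. }
  assert (hTN : strategy_size T <= N) by (unfold N, NB_size; lia).
  assert (hcl : forall Q R, In Q SQ -> In R (subqueries Q) -> In R SQ).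
  { intros Q R. apply all_subqueries_closed. }
  assert (hrootSQ : forall Q, In Q roots -> In Q SQ).
  { intros Q hQ. apply in_flat_map. exists Q. auto using subqueries_refl. }
  assert (hbase : length (base_fmls E SQ) <= N + 1).
  { unfold base_fmls. cbn [length]. rewrite length_flat_subfmls, fmls_size_app.
    pose proof (all_subqueries_atoms_size roots). unfold SQ. lia. }
  (* The summand 3 leaves room for the cut formulas [pvar p] and for the defining formulas of names,
     whatever the size of the input. *)
  assert (hbsize : forall A, In A (base_fmls E SQ) -> fml_size A <= N + 3).
  { intros A [<-|hA]; [simpl; lia|].
    apply in_flat_map in hA as (B & hB & hA). apply subfmls_size in hA.
    apply fml_size_le_in in hB. rewrite fmls_size_app in hB.
    pose proof (all_subqueries_atoms_size roots). unfold SQ in *. lia. }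
  assert (hSQlen : length SQ <= N).
  { pose proof (length_all_subqueries roots). unfold SQ. lia. }
  assert (hSQsize : forall Q, In Q SQ -> query_size Q <= N).
  { intros Q hQ. apply in_flat_map in hQ as (R & hR & hQ).
    apply subqueries_size in hQ. apply query_size_le_in in hR. lia. }
  assert (hW : forall A, In A E -> fml_size A < N + 2).
  { intros A hA. apply fml_size_le_in in hA. lia. }
  destruct (extended_axioms E SQ (N + 2)) as (E' & idx & e1 & e2 & e3 & e4);
    auto; try lia.
  assert (hgen : generated E' (N + 3) (key E SQ Gm Dl T idx) 16 (Gm, Dl)).
  { apply goal_key with (W := N + 2); auto; try lia.
    - intros A hA. apply hrootSQ, in_or_app; left. apply in_map, in_or_app; auto.
    - intros A hA. apply hrootSQ, in_or_app; left. apply in_map, in_or_app; auto.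
    - intros Q hQ. apply hrootSQ, in_or_app; auto. }
  destruct (keys_enumerated E SQ N hSQlen hSQsize hbase Gm Dl T idx hTN)
    as (U & hU & hUlen).
  destruct (generated_deducible E' (24 * (3 * N + 20 + 16 * (N + 3)) + 1)
    (N + 3) (key E SQ Gm Dl T idx) 16 (Gm, Dl) U (2 * N + 20)
    (3 * N + 20 + 16 * (N + 3))) as (pi & p1 & p2 & p3 & p4); auto; try lia.
  { intros s hs. destruct hs as [A B hA hB|t a ht ha|t a ht ha|t a ht ha|A hA|A hA
      |A l k hA hl hk|A l k hA hl hk|l k hl hk|k Q hk hQ|k Q hk hQ|k S hk hS
      |k hk|];
      try (pose proof (base_fmls_atom E SQ _ hA) as hA');
      try (pose proof (hbsize _ hA)); try (pose proof (hbsize _ hA'));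
      try (pose proof (hbsize _ hB));
      try (unfold fmls_size in *; simpl; lia).
    apply tree_paths_length in hS.
    assert (hm : fmls_size
      (map (fun a => FExt (idx [TQ k (fst a) (snd a)])) S) = length S).
    { clear. unfold fmls_size, list_sum. induction S; simpl in *; lia. }
    unfold node_sequent. cbn [fst snd length].
    rewrite !fmls_size_cons, length_app, length_map, fmls_size_app, hm.
    cbn [fml_size length] in *. lia. }
  destruct (proof_of_derivation _ _ _ _ p1 p2 p3) as (pi' & q1 & q2).
  exists E', pi'. repeat split; auto; try apply q1.
  etransitivity; [exact q2|].
  etransitivity; [|apply hbound].
  - unfold proof_size_bound. apply Nat.mul_le_mono_l.
    etransitivity; [exact p4|]. now apply Nat.mul_le_mono_l.
  - unfold N, NB_size. destruct T; simpl; lia.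
Qed.
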